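(* Let $L$ be a rectifiable link in $\mathbb{R}^3$. If $L$ is strongly critical for link-ropelength, then $L$ is $C^1$ (i.e. its arclength parametrization is $C^1$).
   Context: A curve is a continuous map $M\to\mathbb{R}^3$ from a compact oriented 1-manifold with boundary (finitely many components), up to orientation-preserving reparametrization. A link is a closed curve (all components of $M$ are circles) whose different components have disjoint images (a component may intersect itself). A rectifiable curve has finite length and is parametrized by arclength $s$; $T=dL/ds$ is its unit tangent, defined a.e. The link-thickness $\mathrm{LThi}(L)$ is the minimum distance between points on different components of $L$. $\mathrm{VF}^\infty(L)$ is the space of $\mathbb{R}^3$-valued vector fields along $L$ that are smooth functions of arclength. The first variation of length is $\delta_\xi\mathrm{Len}(L)=\int_L\langle T,d\xi/ds\rangle\,ds$, and $\delta^+_\xi\mathrm{LThi}(L)=\frac{d}{dt^+}\big|_{t=0}\mathrm{LThi}(L+t\xi)$ is the one-sided first variation of link-thickness. $L$ is strongly critical for link-ropelength if there is $\varepsilon>0$ such that $\delta^+_\xi\mathrm{LThi}(L)\le-\varepsilon$ for all $\xi\in \mathrm{VF}^\infty(L)$ with $\delta_\xi\mathrm{Len}(L)=-1$. *)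

(* Defs.v *)
From HB Require Import structures.
From mathcomp Require Import all_boot all_order all_algebra.
From mathcomp Require Import all_classical all_reals all_analysis.

Set Implicit Arguments.
Unset Strict Implicit.
Unset Printing Implicit Defensive.

Import Order.TTheory GRing.Theory Num.Theory.
Import numFieldNormedType.Exports.

Local Open Scope classical_set_scope.
Local Open Scope ring_scope.

Section LinkRopelength.
Context {R : realType}.

(* The library norm on 'rV[R]_3 is the maximum norm, hence these two. *)
Definition dot3 (u v : 'rV[R]_3) : R := \sum_(k < 3) u 0 k * v 0 k.

Definition edist3 (u v : 'rV[R]_3) : R := Num.sqrt (dot3 (u - v) (u - v)).

(* Supremum of the lengths of the inscribed polygons, the analogue for space
   curves of [total_variation]. *)
Definition curve_length (a b : R) (f : R -> 'rV[R]_3) : \bar R :=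
  ereal_sup [set (\sum_(0 <= n < size s)
                    edist3 (f (nth b s n)) (f (nth b (a :: s) n)))%:E
            | s in [set s : seq R | itv_partition a b s]].

Section WithComponents.
Context {m : nat}.
Implicit Types (ell : 'I_m -> R) (L xi : 'I_m -> R -> 'rV[R]_3).

(* The i-th component, a map on the circle R / (ell i) Z, is represented by the
   corresponding (ell i)-periodic map on R. *)
Definition is_link ell L : Prop :=
  [/\ forall i, 0 < ell i,
      forall i, continuous (L i),
      forall i, periodic (L i) (ell i) &
      forall i j, i != j -> forall s t, L i s <> L j t].

(* Parametrization by arclength; in particular component i has finite
   length ell i. *)
Definition arclength_parametrized L : Prop :=
  forall i a b, a <= b -> curve_length a b (L i) = (b - a)%:E.

Definition rectifiable_link ell L : Prop :=
  is_link ell L /\ arclength_parametrized L.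

(* With fewer than two components the set is empty and [inf] returns 0. *)
Definition LThi L : R :=
  inf [set d | exists i j s t, i != j /\ d = edist3 (L i s) (L j t)].

Definition smooth_vector_field ell xi : Prop :=
  forall i, periodic (xi i) (ell i) /\
    forall n s, derivable (derive1n n (xi i)) s 1.

(* The unit tangent T = dL/ds exists almost everywhere; [derive1] takes an
   irrelevant value elsewhere. *)
Definition delta_Len ell L xi : R :=
  \sum_(i < m) \int[lebesgue_measure]_(s in `[0, ell i])
    dot3 (derive1 (L i) s) (derive1 (xi i) s).

(* [lim] returns 0 on a divergent difference quotient, and 0 does not
   satisfy the bound <= - eps required below. *)
Definition delta_plus_LThi L xi : R :=
  lim ((t^-1 * (LThi (fun i s => L i s + t *: xi i s) - LThi L))
       @[t --> 0^'+]).

Definition strongly_critical_link_ropelength ell L : Prop :=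
  exists2 eps : R, 0 < eps &
    forall xi, smooth_vector_field ell xi ->
      delta_Len ell L xi = -1 -> delta_plus_LThi L xi <= - eps.

Definition C1_link L : Prop :=
  forall i, (forall s, derivable (L i) s 1) /\ continuous (derive1 (L i)).

End WithComponents.
End LinkRopelength.

(* Main.v *)
Require Import Defs.
From HB Require Import structures.
From mathcomp Require Import all_boot all_order all_algebra.
From mathcomp Require Import all_classical all_reals all_analysis.
From mathcomp Require Import measurable_realfun.
From mathcomp Require Import ring lra.

Set Implicit Arguments.
Unset Strict Implicit.
Unset Printing Implicit Defensive.

Import Order.TTheory GRing.Theory Num.Theory.
Import numFieldNormedType.Exports.

Local Open Scope classical_set_scope.
Local Open Scope ring_scope.

(** The link-thickness changes at rate at most M under a field of size M that
    moves one component. Strong criticality therefore bounds the first variation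
    of length along such a field by M / eps, that is, the unit tangent is a
    function of bounded variation. What remains is to exclude jumps of the
    tangent. At a corner, the points of the other components nearest to it lie
    on the side towards which its tip points, up to small errors; moving the
    corner inwards, in the direction of the jump w of the tangent, decreases
    the length at rate |w|^2 while the thickness does not decrease to first
    order. This contradicts strong criticality unless w = 0.

    The argument is carried out with difference quotients instead of the
    tangent, and with smooth test fields that approximate piecewise linear ones.
    Since the curve is Lipschitz, its coordinates are integrals of their
    derivatives ([nonexpansive_density], by Radon-Nikodym and Lebesgue
    differentiation), so the first variation of length can be integrated by parts
    ([deltaLen_component_field]). The test fields are built from the second
    antiderivative of a trigonometric kernel ([tent]); paired with a coordinate
    of the curve they yield in the limit a difference of two difference
    quotients ([dirichlet_tent_cvg]).

    Bounded variation enters through [slope_oscillation]: on either side of each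
    point the difference quotients over small intervals are nearly equal.
    The corner argument is [corner_estimate]: the difference of the right and
    left difference quotients at scale u tends to 0 with u. Together they say
    that all difference quotients near a point are nearly equal
    ([critical_strict]), which is strict differentiability everywhere and hence
    continuous differentiability ([strict_C1]).

    Existence of the one-sided derivative of the thickness is never proved: only
    lower bounds on difference quotients are needed, because the hypothesis
    itself forces the limits in question to exist. *)

(** * Lipschitz functions as integrals of their derivatives *)

Section LipschitzFTC.
Context {R : realType}.
Implicit Types f g : R -> R.
Local Notation mu := (@lebesgue_measure R).

Definition nonexpansive (f : R -> R) := forall x y, `|f x - f y| <= `|x - y|.

Lemma nonexpansive_continuous f : nonexpansive f -> continuous f.
Proof.
move=> fL x; apply/cvgrPdist_le => e e0.
have /cvgrPdist_le /(_ e e0) := @cvg_id _ (nbhs x).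
by apply: filterS => y; apply: le_trans.
Qed.

Lemma nonexpansive_half_cumulative f : nonexpansive f ->
  nondecreasing (fun x : R => (x + f x) / 2).
Proof.
move=> fL x y xy; have := fL x y.
rewrite [X in _ <= X]distrC [X in _ <= X]ger0_norm ?subr_ge0// => /ler_normlP[]. lra.
Qed.

(** The Stieltjes measures of (x + f x) / 2 and (x - f x) / 2 add up to
    Lebesgue measure, so each of them vanishes on Lebesgue-null sets. *)
Lemma nonexpansive_dominated f (u := fun x : R => (x + f x) / 2) : nonexpansive f ->
  exists nu : {measure set (measurableTypeR R) -> \bar R},
    (forall a b, a <= b -> nu `]a, b]%classic = (u b - u a)%:E) /\ nu `<< mu.
Proof.
move=> fL.
have fLN : nonexpansive (fun x => - f x) by move=> x y; rewrite -opprD normrN; exact: fL.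
have cu : continuous u.
  move=> x; apply: cvgM; last exact: cvg_cst.
  by apply: cvgD; [exact: cvg_id|exact: nonexpansive_continuous].
pose v x := (x - f x) / 2.
have cv : continuous v.
  move=> x; apply: cvgM; last exact: cvg_cst.
  by apply: cvgB; [exact: cvg_id|exact: nonexpansive_continuous].
pose Hu := isCumulative.Build R _ R u (nonexpansive_half_cumulative fL) (right_continuousW cu).
pose Hv := isCumulative.Build R _ R v (nonexpansive_half_cumulative fLN) (right_continuousW cv).
pose U : cumulative R R := HB.pack u Hu.
pose V : cumulative R R := HB.pack v Hv.
have LSE (W : cumulative R R) a b : a <= b ->
    lebesgue_stieltjes_measure W `]a, b]%classic = (W b - W a)%:E.
  move=> ab; rewrite /lebesgue_stieltjes_measure/= /measure_extension/=.
  by rewrite measurable_mu_extE/= ?wlength_itv_bnd//; exact: is_ocitv.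
exists (lebesgue_stieltjes_measure U); split; first exact: LSE.
have addE : forall A, measurable A ->
    mu A = measure_add (lebesgue_stieltjes_measure U) (lebesgue_stieltjes_measure V) A.
  apply: lebesgue_measure_unique => X [[a b] _ <-].
  rewrite [RHS]measure_addE [in LHS]/lebesgue_measure /=.
  have [ab|ba] := leP a b; last by rewrite set_itv_ge ?bnd_simp -?leNgt ?(ltW ba)// !measure0 adde0.
  rewrite !LSE//= -EFinD; congr EFin; rewrite /u /v; lra.
apply/null_content_dominatesP => A mA A0.
have := addE A mA; rewrite [RHS]measure_addE [LHS]A0 => UV0.
by apply/eqP; rewrite eq_le measure_ge0 andbT [leRHS]UV0 leeDl.
Qed.

Lemma ae_neq c : {ae mu, forall x, x <> c}.
Proof.
exists [set c]; split; [exact: measurable_set1|exact: lebesgue_measure_set1|].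
by move=> x /= /contrapT.
Qed.

(** Rademacher's theorem on the line together with the fundamental theorem
    of calculus: the Radon-Nikodym density of the Stieltjes measure of
    (x + f x) / 2 is its derivative at every Lebesgue point.
    The measurable function g stands in for derive1 f, whose values at points
    of non-differentiability are arbitrary. *)
Lemma nonexpansive_density f a b : nonexpansive f -> a < b ->
  exists g : R -> R,
  [/\ mu.-integrable `[a, b] (EFin \o g),
      {ae mu, forall x, a <= x <= b -> derivable f x 1 /\ derive1 f x = g x} &
      \int[mu]_(x in `[a, b]) g x = f b - f a].
Proof.
move=> fL ab; have [nu [nuE nudom]] := nonexpansive_dominated fL.
have mD : measurable (`]a, b]%classic : set (measurableTypeR R)) by exact: measurable_itv.
have nuD : (nu `]a, b]%classic < +oo)%E by rewrite nuE ?ltW// ltry.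
have dom : mfrestr mD nuD `<< mu.
  apply/null_content_dominatesP => A mA A0.
  rewrite /mfrestr /mrestr; apply: (null_content_dominatesP _ _).1 nudom _ _ _.
    exact: measurableI.
  apply/eqP; rewrite eq_le measure_ge0 andbT -A0 le_measure// inE//.
  exact: measurableI.
have [h [h0 hfin ih hE]] := radon_nikodym_sigma_finite dom.
pose g x := fine (h x).
have hg : h = EFin \o g by apply/funext => x; rewrite /= fineK.
rewrite hg in ih.
have igI (D : set R) : measurable D -> mu.-integrable D (EFin \o g).
  by move=> mI; apply: integrableS ih.
have FE x : a <= x <= b -> \int[mu]_(t in `]a, x]) g t = (x + f x) / 2 - (a + f a) / 2.
  move=> /andP[ax xb]; rewrite /Rintegral.
  have -> : (\int[mu]_(t in `]a, x]) (g t)%:E = \int[mu]_(t in `]a, x]) h t)%E.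
    by rewrite hg.
  rewrite -hE//= /mfrestr /mrestr setIidl ?nuE//.
  by apply: subset_itvl; rewrite bnd_simp.
have i1 : mu.-integrable `[a, b] (cst 1%:E).
  apply/integrableP; split; first exact: measurable_cst.
  by rewrite integral_cst//= lebesgue_measure_itv/= lte_fin ab -EFinB normr1 mul1e ltry.
have ig2 : mu.-integrable `[a, b] (EFin \o (fun x => 2 * g x)).
  have -> : EFin \o (fun x => 2 * g x) = (fun x => (2%:E * (EFin \o g) x))%E.
    by apply/funext => x.
  apply: integrableZl => //; exact: igI.
exists (fun x => 2 * g x - 1); split.
- have -> : EFin \o (fun x => 2 * g x - 1) =
     ((EFin \o (fun x => (2 * g x)%R)) \- cst 1)%E.
    by apply/funext => x.
  exact: integrableB.
- have locg : locally_integrable [set: R] g.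
    by apply: open_integrable_locally; [exact: openT|exact: igI].
  have := FTC1 (a := BRight a) (fun y => igI _ (measurable_itv _)) locg.
  move: (ae_neq a) (ae_neq b).
  apply: (@filterS3 _ _ (ae_filter_ringOfSetsType mu)).
  move=> x /eqP xa /eqP xb + /andP[ax0 xb0].
  have ax : a < x by rewrite lt_neqAle eq_sym xa.
  have {}xb : x < b by rewrite lt_neqAle xb.
  move=> /(_ ax)[dF F'].
  pose F y := \int[mu]_(t in `]a, y]) g t.
  have nearF : \forall y \near x, 2 * F y - y + (a + f a) = f y.
    have : \forall y \near x, y \in `]a, b[.
      by apply: near_in_itvoo; rewrite in_itv/= ax.
    apply: filterS => y; rewrite in_itv/= => /andP[ay yb].
    rewrite /F FE; last by rewrite !ltW.
    lra.
  have dF' : is_derive x 1 F (g x).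
    by apply: DeriveDef; [exact: dF|rewrite -F' derive1E].
  have : is_derive x 1 (fun y => 2 * F y - y + (a + f a)) (2 * g x - 1).
    apply: is_derive_eq.
    by rewrite /GRing.scale/=; ring.
  move/(near_eq_is_derive nearF) => [df <-]; split; first exact: df.
  by rewrite derive1E.
- rewrite RintegralB//= RintegralZl//; last exact: igI.
  rewrite -Rintegral_itv_obnd_cbnd; last exact: igI.
  rewrite FE; last by rewrite ltW /=.
  rewrite Rintegral_cst//= lebesgue_measure_itv/= lte_fin ab/=.
  lra.
Qed.

(** Reduction to the nonexpansive case by rescaling f and precomposing it
    with the retraction of the line onto [a, b]. *)
Lemma lip_density f a b K : a < b -> 0 < K ->
  (forall x y, a <= x <= b -> a <= y <= b -> `|f x - f y| <= K * `|x - y|) ->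
  exists g : R -> R,
  [/\ mu.-integrable `[a, b] (EFin \o g),
      {ae mu, forall x, a <= x <= b -> derivable f x 1 /\ derive1 f x = g x} &
      \int[mu]_(x in `[a, b]) g x = f b - f a].
Proof.
move=> ab K0 fK.
pose c x := Num.max a (Num.min b x).
have cab x : a <= c x <= b by rewrite /c; case: (leP b x) => ?; [case: (leP a b)|case: (leP a x)] => ?; lra.
have clip x y : `|c x - c y| <= `|x - y|.
  wlog xy : x y / x <= y.
    move=> H; have [/H//|/ltW/H] := leP x y.
    by rewrite distrC [leRHS]distrC.
  rewrite distrC (distrC x) [leRHS]ger0_norm ?subr_ge0// ler_norml.
  have:= cab x; have := cab y; rewrite /c.
  case: (leP b x) => ?; case: (leP b y) => ?;
    [case: (leP a b)|case: (leP a b); case: (leP a y)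
    |case: (leP a b); case: (leP a x)|case: (leP a x); case: (leP a y)] => *; lra.
have cid x : a <= x <= b -> c x = x.
  by rewrite /c => /andP[ax xb]; rewrite (min_r xb) (max_r ax).
pose h x := K^-1 * f (c x).
have hL : nonexpansive h.
  move=> x y; rewrite /h -mulrBr normrM gtr0_norm ?invr_gt0//.
  rewrite ler_pdivrMl//; apply: le_trans (fK _ _ _ _) _ => //.
  by rewrite ler_pM2l.
have [g [ig gae gE]] := nonexpansive_density hL ab.
exists (fun x => K * g x); split.
- have -> : EFin \o (fun x => K * g x) = (fun x => (K%:E * (EFin \o g) x))%E.
    by apply/funext => x.
  exact: integrableZl.
- move: (ae_neq a) (ae_neq b) gae.
  apply: (@filterS3 _ _ (ae_filter_ringOfSetsType mu)).
  move=> x /eqP xa /eqP xb + /andP[ax0 xb0].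
  rewrite ax0 xb0 => /(_ isT)[dh h'].
  have ax : a < x by rewrite lt_neqAle eq_sym xa.
  have {}xb : x < b by rewrite lt_neqAle xb.
  have nearh : \forall y \near x, K * h y = f y.
    have : \forall y \near x, y \in `]a, b[.
      by apply: near_in_itvoo; rewrite in_itv/= ax.
    apply: filterS => y; rewrite in_itv/= => /andP[ay yb].
    by rewrite /h cid ?ltW ?(ltW ay)// mulrA mulfV ?gt_eqF// mul1r.
  have dh' : is_derive x 1 h (g x).
    by apply: DeriveDef; [exact: dh|rewrite -h' derive1E].
  have : is_derive x 1 (fun y => K * h y) (K * g x).
    by apply: is_derive_eq.
  move/(near_eq_is_derive nearh) => [df <-]; split; first exact: df.
  by rewrite derive1E.
- rewrite RintegralZl// gE /h !cid ?lexx ?ltW//.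
  by rewrite -mulrBr mulrA mulfV ?gt_eqF// mul1r.
Qed.

End LipschitzFTC.

(** * Integrals of functions equal almost everywhere *)

Section IntegralAE.
Local Open Scope ereal_scope.
Context d (T : measurableType d) (R : realType) (mu : {measure set T -> \bar R}).
Import HBNNSimple.

(** The integral of a nonnegative function is a supremum over the simple
    functions below it, and killing a simple function on a null set does not
    change its integral; hence neither f nor g has to be measurable. *)
Lemma ge0_le_integral_off_null (D N : set T) (f g : T -> \bar R) :
  measurable N -> mu N = 0 ->
  (forall x, D x -> 0 <= f x) -> (forall x, D x -> 0 <= g x) ->
  (forall x, D x -> ~ N x -> f x <= g x) ->
  \int[mu]_(x in D) f x <= \int[mu]_(x in D) g x.
Proof.
move=> mN N0 f0 g0 fg; rewrite !ge0_integralE//.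
apply: ge_ereal_sup => _ [h hf <-].
have mNC := measurableC mN.
have projE x : proj_nnsfun h mNC x = (h \_ (~` N)) x by rewrite (mrestrict h mNC).
have -> : sintegral mu h = sintegral mu (proj_nnsfun h mNC).
  rewrite -!integralT_nnsfun; apply: ge0_ae_eq_integral => //.
  - by apply/measurable_EFinP.
  - by apply/measurable_EFinP.
  - by move=> x _; rewrite lee_fin.
  - by move=> x _; rewrite lee_fin.
  - exists N; split => // x; apply: contra_notP => Nx _.
    by rewrite projE patchE mem_set.
apply: ereal_sup_ubound; exists (proj_nnsfun h mNC) => // x.
rewrite projE patchE; have [xN|xN] := pselect (N x).
  rewrite memNset; last by move/(_ xN).
  by rewrite patchE; case: ifPn => // /set_mem; exact: g0.
rewrite mem_set//; apply: le_trans (hf x) _.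
by rewrite !patchE; case: ifPn => // /set_mem xD; exact: fg.
Qed.

Lemma integral_eq_off_null (D N : set T) (f g : T -> \bar R) :
  measurable N -> mu N = 0 ->
  (forall x, D x -> ~ N x -> f x = g x) ->
  \int[mu]_(x in D) f x = \int[mu]_(x in D) g x.
Proof.
move=> mN N0 fg; rewrite integralE [RHS]integralE.
by congr (_ - _); apply/eqP; rewrite eq_le; apply/andP; split;
  apply: (ge0_le_integral_off_null mN N0) => // x Dx Nx;
  rewrite ?funeposE ?funenegE fg.
Qed.

End IntegralAE.

Section RIntegralAE.
Context d (T : measurableType d) (R : realType) (mu : {measure set T -> \bar R}).

Lemma Rintegral_ae_eq (D : set T) (f g : T -> R) :
  {ae mu, forall x, D x -> f x = g x} ->
  \int[mu]_(x in D) f x = \int[mu]_(x in D) g x.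
Proof.
move=> [N [mN N0 fgN]]; rewrite /Rintegral; congr fine.
apply: (integral_eq_off_null mN N0) => x Dx Nx.
by congr EFin; apply: contrapT => fgx; apply: Nx; apply: fgN => /(_ Dx).
Qed.

End RIntegralAE.

(** * Integration by parts for Lipschitz functions *)

Section Parts.
Context {R : realType}.
Implicit Types f g phi : R -> R.
Local Notation mu := (@lebesgue_measure R).

Lemma continuous_bounded_itv f a b : continuous f -> a <= b ->
  exists2 M, 0 < M & forall x, a <= x <= b -> `|f x| <= M.
Proof.
move=> cf ab.
have cn : continuous (fun x => `|f x|).
  by move=> x; apply: cvg_norm; exact: cf.
have [c _ cM] := EVT_max ab (continuous_subspaceT cn).
exists (1 + `|f c|); first by rewrite ltr_pwDl.
by move=> x xab; rewrite (le_trans (cM x _)) ?in_itv// lerDr.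
Qed.

Lemma continuous_integrable_itv f a b : continuous f ->
  mu.-integrable `[a, b] (EFin \o f).
Proof.
move=> cf; apply: continuous_compact_integrable; first exact: segment_compact.
exact: continuous_subspaceT.
Qed.

Lemma derive_lip (phi phi' : R -> R) (a b M : R) : (forall x : R, is_derive x 1 phi (phi' x)) ->
  (forall x, a <= x <= b -> `|phi' x| <= M) ->
  forall x y, a <= x <= b -> a <= y <= b -> `|phi x - phi y| <= M * `|x - y|.
Proof.
move=> dphi phiM.
have cphi : continuous phi.
  by move=> x; apply: differentiable_continuous; apply/derivable1_diffP.
move=> x y; wlog xy : x y / x <= y.
  move=> H xab yab; have [xy|/ltW xy] := leP x y; first exact: H.
  by rewrite distrC (distrC x); exact: H.
move=> /andP[ax xb] /andP[ay yb].
have [c /[!in_itv]/= /andP[xc cy] E] := MVT_segment xy (fun z _ => dphi z) (continuous_subspaceT cphi).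
rewrite distrC E normrM (distrC x) ler_wpM2r// phiM// (le_trans ax)//=.
exact: le_trans yb.
Qed.

(** The product f * phi is Lipschitz on [a, b], so it is the integral of its
    derivative, which is g * phi + f * phi' almost everywhere.
    One density g serves all phi. *)
Lemma nonexpansive_parts f a b : nonexpansive f -> a < b ->
  exists g : R -> R,
    {ae mu, forall x, a <= x <= b -> derivable f x 1 /\ derive1 f x = g x} /\
    forall phi phi' : R -> R, (forall x : R, is_derive x 1 phi (phi' x)) -> continuous phi' ->
      mu.-integrable `[a, b] (EFin \o (fun x => g x * phi x)) /\
      \int[mu]_(x in `[a, b]) (g x * phi x) =
      f b * phi b - f a * phi a - \int[mu]_(x in `[a, b]) (f x * phi' x).
Proof.
move=> fL ab; have [g [ig gae _]] := nonexpansive_density fL ab.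
exists g; split => // phi phi' dphi cphi'.
have cphi : continuous phi.
  by move=> x; apply: differentiable_continuous; apply/derivable1_diffP.
have cf := nonexpansive_continuous fL.
have igphi : mu.-integrable `[a, b] (EFin \o (fun x => g x * phi x)).
  have -> : EFin \o (fun x => g x * phi x) = ((EFin \o g) \* (EFin \o phi))%E.
    by apply/funext => x.
  apply: integrableMl => //.
    apply: measurable_funTS; exact: continuous_measurable_fun.
  have [M M0 phiM] := continuous_bounded_itv cphi (ltW ab).
  exists M; split; first exact: num_real.
  move=> N MN x /=; rewrite in_itv/= => xab.
  by rewrite (le_trans (phiM _ xab))// ltW.
have cfp : continuous (fun x => f x * phi' x).
  by move=> x; apply: cvgM; [exact: cf|exact: cphi'].
have ifp := continuous_integrable_itv a b cfp.
split => //.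
have [M1 M10 M1P] := continuous_bounded_itv cf (ltW ab).
have [M2 M20 M2P] := continuous_bounded_itv cphi (ltW ab).
have [M3 M30 M3P] := continuous_bounded_itv cphi' (ltW ab).
pose p x := f x * phi x.
have pL x y : a <= x <= b -> a <= y <= b -> `|p x - p y| <= (M1 * M3 + M2) * `|x - y|.
  move=> xab yab.
  have -> : p x - p y = f x * (phi x - phi y) + phi y * (f x - f y) by rewrite /p; ring.
  rewrite (le_trans (ler_normD _ _))// mulrDl !normrM -mulrA lerD//.
    by rewrite ler_pM// ?M1P// (derive_lip dphi M3P).
  by rewrite ler_pM// ?M2P// fL.
have M0 : 0 < M1 * M3 + M2 by rewrite addr_gt0// mulr_gt0.
have [q [iq qae qE]] := lip_density ab M0 pL.
rewrite -/(p b) -/(p a) -qE.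
apply/eqP; rewrite -subr_eq opprK; apply/eqP.
rewrite -RintegralD//.
apply: Rintegral_ae_eq.
move: gae qae; apply: (@filterS2 _ _ (ae_filter_ringOfSetsType mu)).
move=> x + + /= xab; rewrite in_itv/= in xab.
move=> /(_ xab)[df f'] /(_ xab)[dp p'].
have dfx : is_derive x 1 f (g x) by apply: DeriveDef; [exact: df|rewrite -f' derive1E].
have dpx : is_derive x 1 p (g x * phi x + f x * phi' x).
  by apply: is_derive_eq; rewrite /GRing.scale/=; ring.
by rewrite -p' derive1E derive_val.
Qed.

End Parts.

(** * An algebra of smooth functions closed under derivation *)

Section SmoothClass.
Context {R : realType}.
Implicit Types f : R -> R.

(** Being closed under differentiation, this class consists of functions all
    of whose iterated derivatives exist, and it contains every test function
    needed below; periodicity is imposed separately because the antiderivatives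
    of a positive periodic kernel have polynomial terms. *)
Inductive elementary : (R -> R) -> Prop :=
| elementary_cst c : elementary (fun=> c)
| elementary_id : elementary (fun x => x)
| elementary_cos u v : elementary (fun x => cos (u * x + v))
| elementary_sin u v : elementary (fun x => sin (u * x + v))
| elementary_add f g : elementary f -> elementary g -> elementary (fun x => f x + g x)
| elementary_mul f g : elementary f -> elementary g -> elementary (fun x => f x * g x).

Lemma elementary_scale c f : elementary f -> elementary (fun x => c * f x).
Proof. by apply: elementary_mul; exact: elementary_cst. Qed.

Lemma elementary_sub f g : elementary f -> elementary g -> elementary (fun x => f x - g x).
Proof.
move=> ef /(elementary_scale (-1)) eg.
have -> : (fun x => f x - g x) = (fun x => f x + -1 * g x).
  by apply/funext => x; rewrite mulN1r.
exact: elementary_add.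
Qed.

Lemma elementary_exp f n : elementary f -> elementary (fun x => f x ^+ n).
Proof.
move=> ef; elim: n => [|n IH]; first exact: elementary_cst.
have -> : (fun x => f x ^+ n.+1) = (fun x => f x * f x ^+ n).
  by apply/funext => x; rewrite exprS.
exact: elementary_mul.
Qed.

Lemma elementary_shift f a : elementary f -> elementary (fun x => f (x + a)).
Proof.
move=> ef; elim: ef a => {f} [c||u v|u v|f g _ IHf _ IHg|f g _ IHf _ IHg] a.
- exact: elementary_cst.
- by apply: elementary_add; [exact: elementary_id|exact: elementary_cst].
- have -> : (fun x => cos (u * (x + a) + v)) = (fun x => cos (u * x + (u * a + v))).
    by apply/funext => x; rewrite mulrDr addrA.
  exact: elementary_cos.
- have -> : (fun x => sin (u * (x + a) + v)) = (fun x => sin (u * x + (u * a + v))).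
    by apply/funext => x; rewrite mulrDr addrA.
  exact: elementary_sin.
- exact: elementary_add.
- exact: elementary_mul.
Qed.

Lemma elementary_derive f : elementary f ->
  exists2 f', elementary f' & forall x : R, is_derive x 1 f (f' x).
Proof.
elim => {f} [c||u v|u v|f g ef [f' ef' df] eg [g' eg' dg]|f g ef [f' ef' df] eg [g' eg' dg]].
- by exists (fun=> 0); [exact: elementary_cst|move=> x; exact: is_derive_cst].
- by exists (fun=> 1); [exact: elementary_cst|move=> x; exact: is_derive_id].
- exists (fun x => - u * sin (u * x + v)); first exact/elementary_scale/elementary_sin.
  by move=> x; apply: is_derive_eq; rewrite /GRing.scale/=; ring.
- exists (fun x => u * cos (u * x + v)); first exact/elementary_scale/elementary_cos.
  by move=> x; apply: is_derive_eq; rewrite /GRing.scale/=; ring.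
- exists (fun x => f' x + g' x); first exact: elementary_add.
  by move=> x; apply: is_derive_eq.
- exists (fun x => f x * g' x + g x * f' x).
    by apply: elementary_add; exact: elementary_mul.
  by move=> x; apply: is_derive_eq; rewrite /GRing.scale/=; ring.
Qed.

Lemma elementary_continuous f : elementary f -> continuous f.
Proof.
move=> /elementary_derive[f' _ df] x; apply: differentiable_continuous.
exact/derivable1_diffP.
Qed.

Lemma elementary_derive1 f : elementary f -> elementary (derive1 f).
Proof.
move=> /elementary_derive[f' ef' df].
rewrite (_ : derive1 f = f')//; apply/funext => x.
by rewrite derive1E derive_val.
Qed.

Lemma elementary_smooth f : elementary f -> forall n s, derivable (derive1n n f) s 1.
Proof.
move=> ef n s; have : elementary (derive1n n f).
  elim: n => [//|n IH]; rewrite derive1nS; exact: elementary_derive1.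
by move=> /elementary_derive[f' _ df]; exact: ex_derive.
Qed.

End SmoothClass.

(** * The de la Vallee-Poussin kernel and its antiderivatives *)

Section Kernel.
Context {R : realType}.
Local Notation mu := (@lebesgue_measure R).

Lemma Rintegral_FTC2 (F F' : R -> R) (a b : R) : a < b ->
  (forall x : R, is_derive x 1 F (F' x)) -> continuous F' ->
  \int[mu]_(x in `[a, b]) F' x = F b - F a.
Proof.
move=> ab dF cF'.
have cF : continuous F.
  by move=> x; apply: differentiable_continuous; apply/derivable1_diffP.
rewrite /Rintegral (continuous_FTC2 (F := F))//.
- exact: continuous_subspaceT.
- split.
  + by move=> x _; exact: ex_derive.
  + by apply: cvg_at_right_filter; exact: cF.
  + by apply: cvg_at_left_filter; exact: cF.
- by move=> x _; rewrite derive1E derive_val.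
Qed.

Lemma is_derive_pow (f : R -> R) (x df : R) n : is_derive x 1 f df ->
  is_derive x 1 (fun y => f y ^+ n.+1) (n.+1%:R * f x ^+ n * df).
Proof.
move=> H; elim: n => [|n IH].
  by under eq_fun do rewrite expr1; rewrite expr0 !mul1r.
under eq_fun do rewrite exprS.
by apply: is_derive_eq; rewrite /GRing.scale/= -[n.+2%:R]natr1 exprS; ring.
Qed.

Lemma derive_ge0_homo (F F' : R -> R) (a b : R) : a <= b ->
  (forall x : R, is_derive x 1 F (F' x)) ->
  (forall x, a <= x <= b -> 0 <= F' x) -> F a <= F b.
Proof.
move=> ab dF F'0.
have cF : continuous F.
  by move=> x; apply: differentiable_continuous; apply/derivable1_diffP.
have [c /[!in_itv]/= cab E] := MVT_segment ab (fun z _ => dF z) (continuous_subspaceT cF).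
by rewrite -subr_ge0 E mulr_ge0 ?F'0// subr_ge0.
Qed.

Lemma is_derive_shift (F F' : R -> R) (a : R) : (forall x : R, is_derive x 1 F (F' x)) ->
  forall x : R, is_derive x 1 (fun s => F (s - a)) (F' (x - a)).
Proof.
move=> dF x; have H := dF (x - a).
have H2 : is_derive x 1 (fun s => s - a) 1 by apply: is_derive_eq; rewrite subr0.
by have := @is_derive1_comp _ F (fun s => s - a) x _ _ H H2; rewrite mulr1.
Qed.

Lemma cvg_div_succ (M : R) : M / (n%:R + 1) @[n --> \oo] --> (0 : R).
Proof.
rewrite -(mulr0 M); apply: cvgM; first exact: cvg_cst.
by under eq_fun do rewrite natr1; exact: cvg_harmonic.
Qed.

Variable (ell : R).
Hypothesis ell0 : 0 < ell.
Let th : R := 2 * pi / ell.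

(** The integral of (1 + cos (th x)) ^ n over a period; the recursion holds
    because the derivative of sin * (1 + cos) ^ n has integral 0. *)
Fixpoint vp_mass (n : nat) : R :=
  if n is n'.+1 then (2 * n'%:R + 1) / (n'%:R + 1) * vp_mass n' else ell.

Definition vp_kernel n (x : R) : R := (1 + cos (th * x)) ^+ n / vp_mass n.

(** An antiderivative of the kernel in closed form. It grows by 1 over each
    period and approximates a staircase with jumps at the multiples of ell. *)
Fixpoint vp_step (n : nat) (x : R) : R :=
  if n is n'.+1
  then vp_step n' x + sin (th * x) * (1 + cos (th * x)) ^+ n' /
                   (th * (2 * n'%:R + 1) * vp_mass n')
  else x / ell.

(** An antiderivative of vp_step: an approximate convex piecewise linear
    function. *)
Fixpoint vp_ramp (n : nat) (x : R) : R :=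
  if n is n'.+1
  then vp_ramp n' x - (1 + cos (th * x)) ^+ n'.+1 /
                   (th ^+ 2 * (2 * n'%:R + 1) * (n'%:R + 1) * vp_mass n')
  else x ^+ 2 / (2 * ell).

Let th0 : 0 < th. Proof. by rewrite divr_gt0// mulr_gt0// pi_gt0. Qed.

Let n1_gt0 n : 0 < n%:R + 1 :> R. Proof. by rewrite ltr_wpDl. Qed.
Let n21_gt0 n : 0 < 2 * n%:R + 1 :> R. Proof. by rewrite ltr_wpDl// mulr_ge0. Qed.

Lemma vp_massS n : vp_mass n.+1 = (2 * n%:R + 1) / (n%:R + 1) * vp_mass n.
Proof. by []. Qed.

Lemma vp_mass_gt0 n : 0 < vp_mass n.
Proof. by elim: n => //= n IH; rewrite mulr_gt0// divr_gt0. Qed.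

Lemma vp_kernel_ge0 n x : 0 <= vp_kernel n x.
Proof.
apply: divr_ge0; last exact/ltW/vp_mass_gt0.
apply: exprn_ge0.
by have := cos_geN1 (th * x); lra.
Qed.

Let dcos (x : R) n : is_derive x 1 (fun y => (1 + cos (th * y)) ^+ n.+1)
  (- (n.+1%:R * th * sin (th * x) * (1 + cos (th * x)) ^+ n)).
Proof.
have H : is_derive x 1 (fun y => 1 + cos (th * y)) (- (th * sin (th * x))).
  by apply: is_derive_eq; rewrite /GRing.scale/=; ring.
by apply: (is_derive_eq (is_derive_pow n H)); ring.
Qed.

Lemma is_derive_vp_ramp n (x : R) : is_derive x 1 (vp_ramp n) (vp_step n x).
Proof.
elim: n => [|n IH] /=.
  have H := is_derive_pow 1 (is_derive_id x 1).
  apply: is_derive_eq; rewrite /GRing.scale/= expr1; field; by rewrite gt_eqF.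
have H := dcos x n.
apply: is_derive_eq; rewrite /GRing.scale/=.
rewrite -natr1; field.
by rewrite !gt_eqF// ?vp_mass_gt0.
Qed.

Lemma is_derive_vp_step n (x : R) : is_derive x 1 (vp_step n) (vp_kernel n x).
Proof.
elim: n => [|n IH] /=.
  apply: is_derive_eq; rewrite /vp_kernel /= /GRing.scale/= expr0; field; by rewrite gt_eqF.
have sc : sin (th * x) ^+ 2 = (1 - cos (th * x)) * (1 + cos (th * x)).
  by rewrite sin2cos2; ring.
case: n IH => [|n] IH.
  have H : is_derive x 1 (fun y => (1 + cos (th * y)) ^+ 0) 0.
    by under eq_fun do rewrite expr0; exact: is_derive_cst.
  apply: is_derive_eq; rewrite /vp_kernel /= /GRing.scale/= !expr0 expr1.
  by field; rewrite !gt_eqF.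
have H := dcos x n.
have -> : vp_kernel n.+2 x = vp_kernel n.+1 x +
   ((sin (th * x) * (- (n.+1%:R * th * sin (th * x) * (1 + cos (th * x)) ^+ n)) +
    (1 + cos (th * x)) ^+ n.+1 * (cos (th * x) * th)) /
    (th * (2 * n.+1%:R + 1) * vp_mass n.+1)).
  have -> : sin (th * x) * - (n.+1%:R * th * sin (th * x) * (1 + cos (th * x)) ^+ n) =
    - (n.+1%:R * th * (1 - cos (th * x)) * (1 + cos (th * x)) ^+ n.+1).
    transitivity (- (n.+1%:R * th * (sin (th * x) ^+ 2) * (1 + cos (th * x)) ^+ n)).
      by ring.
    by rewrite sc exprS; ring.
  rewrite /vp_kernel (vp_massS n.+1) [(1 + _) ^+ n.+2]exprS.
  move: (vp_mass_gt0 n.+1) ((1 + _) ^+ n.+1) (n1_gt0 n.+1) (n21_gt0 n.+1) => M0 E N1 N2.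
  by field; rewrite !gt_eqF.
apply: is_derive_eq; rewrite /GRing.scale/=; field.
by rewrite !gt_eqF// ?vp_mass_gt0.
Qed.

Let thell : th * ell = pi *+ 2.
Proof. by rewrite /th mulrVK ?unitfE ?gt_eqF// mulr2n; ring. Qed.

Let cosD x : cos (th * (x + ell)) = cos (th * x).
Proof. by rewrite mulrDr thell cosD2pi. Qed.

Let sinD x : sin (th * (x + ell)) = sin (th * x).
Proof. by rewrite mulrDr thell sinD2pi. Qed.

Lemma vp_stepD n x : vp_step n (x + ell) = vp_step n x + 1.
Proof.
elim: n => [|n IH] /=; first by rewrite mulrDl mulfV ?gt_eqF.
by rewrite IH cosD sinD addrAC.
Qed.

Lemma vp_rampD n x : vp_ramp n (x + ell) = vp_ramp n x + x + ell / 2.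
Proof.
elim: n => [|n IH] /=; first by field; rewrite gt_eqF.
by rewrite IH cosD; ring.
Qed.

Lemma vp_step_nd n : {homo vp_step n : x y / x <= y}.
Proof.
move=> x y xy; apply: (derive_ge0_homo xy (is_derive_vp_step n)) => z _.
exact: vp_kernel_ge0.
Qed.

(** The kernels form an approximate identity because the left-hand side has
    integral 2 - (2n + 1)/(n + 1) = 1/(n + 1) over a period. *)
Lemma vp_kernel_moment n x : (1 - cos (th * x)) * vp_kernel n x =
  2 * vp_kernel n x - (2 * n%:R + 1) / (n%:R + 1) * vp_kernel n.+1 x.
Proof.
rewrite /vp_kernel vp_massS exprS; have M0 := vp_mass_gt0 n.
by field; rewrite !gt_eqF.
Qed.

Let moment n x := 2 * vp_step n x - (2 * n%:R + 1) / (n%:R + 1) * vp_step n.+1 x.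

Let is_derive_moment n (x : R) :
  is_derive x 1 (moment n) ((1 - cos (th * x)) * vp_kernel n x).
Proof.
have H1 := is_derive_vp_step n x; have H2 := is_derive_vp_step n.+1 x.
by rewrite vp_kernel_moment; apply: is_derive_eq.
Qed.

Let momentD n x : moment n (x + ell) = moment n x + (n%:R + 1)^-1.
Proof. by rewrite /moment !vp_stepD; field; rewrite gt_eqF. Qed.

Lemma cos_antipodal h x : 0 <= h -> h <= x <= ell - h ->
  cos (th * x) <= cos (th * h).
Proof.
move=> h0 /andP[hx xl].
wlog xh : x hx xl / x <= ell / 2.
  move=> H; have [|xh] := leP x (ell / 2); first exact: H.
  have -> : cos (th * x) = cos (th * (ell - x)).
    by rewrite [ell - x]addrC cosD mulrN cosN.
  by apply: H; lra.
have thE : th * (ell / 2) = pi by rewrite mulrA thell; field.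
have inI y : 0 <= y -> y <= ell / 2 -> th * y \in `[0, pi].
  by move=> y0 yl; rewrite in_itv/= -thE mulr_ge0 ?ler_pM2l// ltW.
rewrite leNgt ltr_cos ?inI//; [|lra..].
by rewrite -leNgt ler_pM2l.
Qed.

(** Compare the mass of the kernel away from 0 with its moment against
    1 - cos, as in Chebyshev's inequality. *)
Lemma vp_step_tail n h : 0 < h -> h <= ell - h ->
  (1 - cos (th * h)) * (vp_step n (ell - h) - vp_step n h) <= (n%:R + 1)^-1.
Proof.
move=> h0 hl.
have nd x y : x <= y -> moment n x <= moment n y.
  move=> xy; apply: (derive_ge0_homo xy (is_derive_moment n)) => z _.
  by rewrite mulr_ge0 ?vp_kernel_ge0// subr_ge0 cos_le1.
have H : moment n h - (1 - cos (th * h)) * vp_step n h <=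
    moment n (ell - h) - (1 - cos (th * h)) * vp_step n (ell - h).
  apply: (@derive_ge0_homo (fun z => moment n z - (1 - cos (th * h)) * vp_step n z)
    (fun z => (cos (th * h) - cos (th * z)) * vp_kernel n z)) => //.
    move=> x; have H1 := is_derive_moment n x; have H2 := is_derive_vp_step n x.
    by apply: is_derive_eq; rewrite /GRing.scale/=; ring.
  move=> x /andP[hx xl]; rewrite mulr_ge0 ?vp_kernel_ge0// subr_ge0.
  by apply: cos_antipodal; [exact: ltW|rewrite hx xl].
have := nd _ _ (ltW h0); have : moment n (ell - h) <= moment n ell.
  by apply: nd; lra.
have := momentD n 0; rewrite add0r.
lra.
Qed.

Lemma elementary_vp_ramp n : elementary (vp_ramp n).
Proof.
elim: n => [|n IH].
  have -> : vp_ramp 0 = (fun x => (2 * ell)^-1 * x ^+ 2).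
    by apply/funext => x /=; rewrite mulrC.
  exact/elementary_scale/elementary_exp/elementary_id.
pose C := (th ^+ 2 * (2 * n%:R + 1) * (n%:R + 1) * vp_mass n)^-1.
have -> : vp_ramp n.+1 = (fun x => vp_ramp n x - C * (1 + cos (th * x + 0)) ^+ n.+1).
  by apply/funext => x /=; rewrite addr0 mulrC.
apply: elementary_sub IH _; apply/elementary_scale/elementary_exp/elementary_add; first exact: elementary_cst.
exact: elementary_cos.
Qed.

Lemma vp_kernel_continuous n : continuous (vp_kernel n).
Proof.
apply: elementary_continuous.
have -> : vp_kernel n = (fun x => (vp_mass n)^-1 * (1 + cos (th * x + 0)) ^+ n).
  by apply/funext => x; rewrite addr0 mulrC.
apply/elementary_scale/elementary_exp/elementary_add; first exact: elementary_cst.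
exact: elementary_cos.
Qed.

Lemma periodicz (f : R -> R) : periodic f ell -> forall (k : int) x, f (x + k%:~R * ell) = f x.
Proof.
move=> fp k x; case: k => n.
  by rewrite -(periodicn fp n x) -mulr_natl.
rewrite NegzE -(periodicn fp n.+1 (x + _)) -mulr_natl; congr f.
by rewrite mulrNz mulNr -pmulrn subrK.
Qed.

Lemma period_reduce x : exists k : int, 0 <= x - k%:~R * ell < ell.
Proof.
exists (Num.floor (x / ell)).
have /andP[] := floor_itv (x / ell).
rewrite ler_pdivlMr// ltr_pdivrMr// intrD mulrDl mul1r; lra.
Qed.

Lemma cos_lt1 h : 0 < h -> h < ell / 2 -> cos (th * h) < 1.
Proof.
move=> h0 hl.
have thE : th * (ell / 2) = pi by rewrite mulrA thell; field.
have I0 : (0 : R) \in `[0, pi] by rewrite in_itv/= lexx pi_ge0.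
have Ih : th * h \in `[0, pi].
  by rewrite in_itv/= -thE ler_pM2l// !ltW// mulr_gt0.
by rewrite -cos0 ltr_cos// mulr_gt0.
Qed.

Lemma vp_step_flat h : 0 < h -> h < ell / 2 -> exists2 D, 0 <= D &
  forall n, vp_step n (ell - h) - vp_step n h <= D / (n%:R + 1).
Proof.
move=> h0 hl; have c0 : 0 < 1 - cos (th * h) by rewrite subr_gt0 cos_lt1.
exists (1 - cos (th * h))^-1; first by rewrite invr_ge0 ltW.
move=> n; rewrite mulrC ler_pdivlMr// mulrC; apply: vp_step_tail => //.
by move: hl; rewrite ltr_pdivlMr//; lra.
Qed.

(** The penalty 1 - cos is the one whose integral against the kernel is
    known, so this bound turns uniform continuity on the circle into an error
    term M / (n + 1) in the approximation below. *)
Lemma nonexpansive_periodic_modulus f : nonexpansive f -> periodic f ell ->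
  forall e, 0 < e -> exists2 M, 0 <= M &
    forall s a, `|f s - f a| <= e + M * (1 - cos (th * (s - a))).
Proof.
move=> fL fp e e0.
have cos1 x : 0 <= 1 - cos (th * x) by rewrite subr_ge0 cos_le1.
have M0 : 0 <= ell / (1 - cos (th * e)) by rewrite divr_ge0// ltW.
exists (ell / (1 - cos (th * e))) => // s a.
have [k /andP[y0 yl]] := period_reduce (s - a).
set y := s - a - _ in y0 yl.
have cosE : cos (th * (s - a)) = cos (th * y).
  by rewrite -(@periodicz (fun z => cos (th * z)) cosD k y) /y subrK.
have fE : f s = f (a + y).
  by rewrite -(periodicz fp k (a + y)); congr f; rewrite /y; ring.
rewrite cosE fE.
have [ye|ye] := leP y e.
  rewrite (le_trans (fL _ _))// addrC addKr ger0_norm//.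
  by rewrite ler_wpDr// mulr_ge0.
have [yle|yle] := leP (ell - y) e.
  have -> : f (a + y) = f (a + (y - ell)) by rewrite -(fp (a + (y - ell))); congr f; ring.
  rewrite (le_trans (fL _ _))// addrC addKr ler0_norm; last lra.
  have := mulr_ge0 M0 (cos1 y); lra.
have ce : 0 < 1 - cos (th * e) by rewrite subr_gt0 cos_lt1//; lra.
have H : ell <= ell / (1 - cos (th * e)) * (1 - cos (th * y)).
  rewrite mulrAC ler_pdivlMr// ler_pM2l// lerB// cos_antipodal// ?ltW//=.
  by lra.
rewrite (le_trans (fL _ _))// addrC addKr ger0_norm//; lra.
Qed.

Lemma vp_kernel_shift_continuous n a : continuous (fun s => vp_kernel n (s - a)).
Proof.
move=> x; apply: (@continuous_comp _ _ _ (fun s => s - a)).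
  by apply: cvgB; [exact: cvg_id|exact: cvg_cst].
exact: vp_kernel_continuous.
Qed.

Lemma vp_kernel_approx_le (f : R -> R) (a e M : R) n : continuous f -> 0 <= M ->
  (forall s, f s <= f a + e + M * (1 - cos (th * (s - a)))) ->
  \int[mu]_(s in `[0, ell]) (f s * vp_kernel n (s - a)) <= f a + e + M / (n%:R + 1).
Proof.
move=> cf M0 fM.
pose F s := (f a + e) * vp_step n (s - a) + M * moment n (s - a).
pose F' s := (f a + e + M * (1 - cos (th * (s - a)))) * vp_kernel n (s - a).
have dF (x : R) : is_derive x 1 F (F' x).
  have H1 := is_derive_shift a (is_derive_vp_step n) x.
  have H2 := is_derive_shift a (is_derive_moment n) x.
  by apply: is_derive_eq; rewrite /F' /GRing.scale/=; ring.
have ck := @vp_kernel_shift_continuous n a.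
have cF' : continuous F'.
  move=> x; apply: cvgM; last exact: ck.
  have : elementary (fun s => f a + e + M * (1 - cos (th * s + th * (- a)))).
    apply/elementary_add; first exact: elementary_cst.
    by apply/elementary_scale/elementary_sub; [exact: elementary_cst|exact: elementary_cos].
  move/elementary_continuous => /(_ x); rewrite /continuous_at/=.
  by under eq_fun do rewrite -mulrDr; rewrite -mulrDr.
have -> : f a + e + M / (n%:R + 1) = \int[mu]_(s in `[0, ell]) F' s.
  rewrite (Rintegral_FTC2 ell0 dF cF') /F.
  have -> : ell - a = (0 - a) + ell by ring.
  by rewrite vp_stepD momentD; ring.
apply: le_Rintegral => //.
- apply: continuous_integrable_itv => x.
  by apply: cvgM; [exact: cf|exact: ck].
- exact: continuous_integrable_itv.
- by move=> x _; rewrite ler_wpM2r ?vp_kernel_ge0.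
Qed.

Lemma vp_kernel_approx (f : R -> R) (a : R) : nonexpansive f -> periodic f ell ->
  \int[mu]_(s in `[0, ell]) (f s * vp_kernel n (s - a)) @[n --> \oo] --> f a.
Proof.
move=> fL fp; apply/cvgrPdist_le => e e0.
have e20 : 0 < e / 2 by rewrite divr_gt0.
have [M M0 fM] := nonexpansive_periodic_modulus fL fp e20.
have cf := nonexpansive_continuous fL.
have cnf : continuous (fun x => - f x) by move=> x; apply: cvgN; exact: cf.
have /cvgrPdist_le /(_ _ e20) := cvg_div_succ M.
apply: filterS => n; rewrite sub0r normrN => /ler_normlW H4.
have H1 : \int[mu]_(s in `[0, ell]) (f s * vp_kernel n (s - a)) <= f a + e / 2 + M / (n%:R + 1).
  apply: vp_kernel_approx_le => // s.
  by have /ler_normlP[] := fM s a; lra.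
have H2 : \int[mu]_(s in `[0, ell]) (- f s * vp_kernel n (s - a)) <= - f a + e / 2 + M / (n%:R + 1).
  apply: (@vp_kernel_approx_le (fun x => - f x)) => // s.
  by have /ler_normlP[] := fM s a; lra.
have H3 : \int[mu]_(s in `[0, ell]) (- f s * vp_kernel n (s - a)) =
   - (\int[mu]_(s in `[0, ell]) (f s * vp_kernel n (s - a))).
  have -> : - (\int[mu]_(s in `[0, ell]) (f s * vp_kernel n (s - a))) =
      -1 * (\int[mu]_(s in `[0, ell]) (f s * vp_kernel n (s - a))) by rewrite mulN1r.
  rewrite -RintegralZl//.
    by apply: eq_Rintegral => x _; rewrite mulN1r mulNr.
  apply: continuous_integrable_itv => x.
  by apply: cvgM; [exact: cf|exact: vp_kernel_shift_continuous].
rewrite H3 in H2; change (`|f a - \int[mu]_(s in `[0, ell]) (f s * vp_kernel n (s - a))| <= e).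
move: (\int[mu]_(s in `[0, ell]) (f s * vp_kernel n (s - a))) {H3} H1 H2 => I H1 H2.
by rewrite ler_norml; lra.
Qed.

End Kernel.

(** * Periodic test functions and the first variation of length *)

Section TestFunctions.
Context {R : realType}.
Local Notation mu := (@lebesgue_measure R).
Variable ell : R.
Hypothesis ell0 : 0 < ell.
Implicit Types f psi : R -> R.

Definition test_function psi := elementary psi /\ periodic psi ell.

(** For Lipschitz periodic f this is the integral of f' * psi' over a period,
    integrated by parts so that only values of f occur. *)
Definition dirichlet f psi : R :=
  - \int[mu]_(s in `[0, ell]) (f s * derive1 (derive1 psi) s).

Definition slope f a b : R := (f b - f a) / (b - a).

(** A smooth substitute for the trapezoid whose slope is 1 / (a1 - a0) on
    [a0, a1] and - 1 / (b1 - b0) on [b0, b1]: pairing f with it gives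
    approximately the difference of the two difference quotients of f. The
    quadratic terms of the ramps cancel, which makes it periodic. *)
Definition tent n (a0 a1 b0 b1 s : R) : R :=
  (vp_ramp ell n (s - a0) - vp_ramp ell n (s - a1)) / (a1 - a0) -
  (vp_ramp ell n (s - b0) - vp_ramp ell n (s - b1)) / (b1 - b0).

Lemma test_function0 : test_function (fun=> 0).
Proof. by split => //; exact: elementary_cst. Qed.

Lemma test_function_add psi1 psi2 : test_function psi1 -> test_function psi2 ->
  test_function (fun s => psi1 s + psi2 s).
Proof.
move=> [e1 p1] [e2 p2]; split; first exact: elementary_add.
by move=> s; rewrite p1 p2.
Qed.

Lemma test_function_scale c psi : test_function psi -> test_function (fun s => c * psi s).
Proof.
move=> [e p]; split; first exact: elementary_scale.
by move=> s; rewrite p.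
Qed.

Lemma derive1_ext (f f' : R -> R) : (forall x : R, is_derive x 1 f (f' x)) ->
  derive1 f = f'.
Proof. by move=> df; apply/funext => x; rewrite derive1E derive_val. Qed.

Lemma is_derive_elementary f : elementary f -> forall x : R, is_derive x 1 f (derive1 f x).
Proof. by move=> /elementary_derive[f' _ df]; rewrite (derive1_ext df). Qed.

Lemma derive1_add f g : elementary f -> elementary g ->
  derive1 (fun s => f s + g s) = (fun s => derive1 f s + derive1 g s).
Proof.
move=> /is_derive_elementary df /is_derive_elementary dg; exact: derive1_ext.
Qed.

Lemma derive1_scale c f : elementary f ->
  derive1 (fun s => c * f s) = (fun s => c * derive1 f s).
Proof.
move=> /is_derive_elementary df; exact: derive1_ext.
Qed.

Lemma dirichlet_integrable f psi : continuous f -> elementary psi ->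
  mu.-integrable `[0, ell] (EFin \o (fun s => f s * derive1 (derive1 psi) s)).
Proof.
move=> cf e; apply: continuous_integrable_itv => x; apply: cvgM; first exact: cf.
by apply: elementary_continuous; do 2 apply: elementary_derive1.
Qed.

Lemma dirichlet_add f psi1 psi2 : continuous f -> elementary psi1 -> elementary psi2 ->
  dirichlet f (fun s => psi1 s + psi2 s) = dirichlet f psi1 + dirichlet f psi2.
Proof.
move=> cf e1 e2; rewrite /dirichlet -opprD -RintegralD//; [|exact: dirichlet_integrable..].
congr (- _); apply: eq_Rintegral => s _.
by rewrite derive1_add// derive1_add ?mulrDr//; exact: elementary_derive1.
Qed.

Lemma dirichlet_scale f c psi : continuous f -> elementary psi ->
  dirichlet f (fun s => c * psi s) = c * dirichlet f psi.
Proof.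
move=> cf e; rewrite /dirichlet mulrN -RintegralZl//; last exact: dirichlet_integrable.
congr (- _); apply: eq_Rintegral => s _.
by rewrite derive1_scale// derive1_scale; [rewrite mulrCA|exact: elementary_derive1].
Qed.

Lemma dirichlet0 f : continuous f -> dirichlet f (fun=> 0) = 0.
Proof.
move=> cf; have := dirichlet_scale 0 cf (elementary_cst (0 : R)).
by rewrite !mul0r.
Qed.

Lemma test_function_tent n a0 a1 b0 b1 : a0 < a1 -> b0 < b1 -> test_function (tent n a0 a1 b0 b1).
Proof.
move=> a01 b01; split.
  have -> : tent n a0 a1 b0 b1 = (fun s =>
     (a1 - a0)^-1 * (vp_ramp ell n (s + - a0) - vp_ramp ell n (s + - a1)) -
     (b1 - b0)^-1 * (vp_ramp ell n (s + - b0) - vp_ramp ell n (s + - b1))).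
    by apply/funext => s; rewrite /tent ![_^-1 * _]mulrC.
  have er a : elementary (fun s => vp_ramp ell n (s + a)) by apply/elementary_shift/elementary_vp_ramp.
  by apply/elementary_sub; apply/elementary_scale/elementary_sub.
move=> s; rewrite /tent.
have rE a : vp_ramp ell n (s + ell - a) = vp_ramp ell n (s - a) + (s - a) + ell / 2.
  by rewrite addrAC vp_rampD.
rewrite !rE; field; rewrite !subr_eq0 !gt_eqF//.
Qed.

(** The quotient is the mean of vp_step over [s - a1, s - a0]. *)
Lemma vp_ramp_mean n a0 a1 s : a0 < a1 ->
  vp_step ell n (s - a1) <= (vp_ramp ell n (s - a0) - vp_ramp ell n (s - a1)) / (a1 - a0)
    <= vp_step ell n (s - a0).
Proof.
move=> a01; have le1 : s - a1 <= s - a0 by rewrite lerD2l lerN2 ltW.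
have cr : continuous (vp_ramp ell n) by apply: elementary_continuous; exact: elementary_vp_ramp.
have [c /[!in_itv]/= /andP[c1 c2] ->] :=
  MVT_segment le1 (fun z _ => is_derive_vp_ramp ell0 n z) (continuous_subspaceT cr).
have -> : s - a0 - (s - a1) = a1 - a0 by ring.
by rewrite mulfK ?subr_eq0 ?gt_eqF// !vp_step_nd.
Qed.

(** The right-hand side is a smoothed indicator of [c, d]. Such bounds add up
    telescopically over adjacent intervals, so sums of tents over disjoint
    intervals stay bounded by 1 without any tail estimate. *)
Lemma tent_bound n a0 a1 b0 b1 c d s : a0 < a1 -> b0 < b1 ->
  c <= a0 -> a1 <= d -> c <= b0 -> b1 <= d ->
  `|tent n a0 a1 b0 b1 s| <= vp_step ell n (s - c) - vp_step ell n (s - d).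
Proof.
move=> a01 b01 ca ad cb bd.
have /andP[A1 A2] := vp_ramp_mean n s a01; have /andP[B1 B2] := vp_ramp_mean n s b01.
have nd x y : x <= y -> vp_step ell n (s - y) <= vp_step ell n (s - x).
  by move=> xy; apply: vp_step_nd => //; rewrite lerD2l lerN2.
have := nd _ _ ca; have := nd _ _ ad; have := nd _ _ cb; have := nd _ _ bd.
rewrite /tent ler_norml; lra.
Qed.

Lemma tent_ge0 n a0 a1 b0 b1 s : a0 < a1 -> a1 <= b0 -> b0 < b1 ->
  0 <= tent n a0 a1 b0 b1 s.
Proof.
move=> a01 ab b01.
have /andP[A1 A2] := vp_ramp_mean n s a01; have /andP[B1 B2] := vp_ramp_mean n s b01.
have : vp_step ell n (s - b0) <= vp_step ell n (s - a1).
  by apply: vp_step_nd => //; rewrite lerD2l lerN2.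
rewrite /tent; lra.
Qed.

Lemma derive2_tent n a0 a1 b0 b1 :
  derive1 (derive1 (tent n a0 a1 b0 b1)) = (fun s =>
  (vp_kernel ell n (s - a0) - vp_kernel ell n (s - a1)) / (a1 - a0) -
  (vp_kernel ell n (s - b0) - vp_kernel ell n (s - b1)) / (b1 - b0)).
Proof.
have dr a (x : R) := is_derive_shift a (is_derive_vp_ramp ell0 n) x.
have ds a (x : R) := is_derive_shift a (is_derive_vp_step ell0 n) x.
have dt (x : R) : is_derive x 1 (tent n a0 a1 b0 b1)
    ((vp_step ell n (x - a0) - vp_step ell n (x - a1)) / (a1 - a0) -
     (vp_step ell n (x - b0) - vp_step ell n (x - b1)) / (b1 - b0)).
  have := dr a0 x; have := dr a1 x; have := dr b0 x; have := dr b1 x => ? ? ? ?.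
  by apply: is_derive_eq; rewrite /GRing.scale/=; ring.
rewrite (derive1_ext dt).
have dt2 (x : R) : is_derive x 1 (fun x =>
    ((vp_step ell n (x - a0) - vp_step ell n (x - a1)) / (a1 - a0) -
     (vp_step ell n (x - b0) - vp_step ell n (x - b1)) / (b1 - b0)))
    ((vp_kernel ell n (x - a0) - vp_kernel ell n (x - a1)) / (a1 - a0) -
     (vp_kernel ell n (x - b0) - vp_kernel ell n (x - b1)) / (b1 - b0)).
  have := ds a0 x; have := ds a1 x; have := ds b0 x; have := ds b1 x => ? ? ? ?.
  by apply: is_derive_eq; rewrite /GRing.scale/=; ring.
exact: (derive1_ext dt2).
Qed.

Lemma dirichlet_tent_cvg f a0 a1 b0 b1 : nonexpansive f -> periodic f ell ->
  dirichlet f (tent n a0 a1 b0 b1) @[n --> \oo] --> slope f a0 a1 - slope f b0 b1.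
Proof.
move=> fL fp.
have K a := @vp_kernel_approx R ell ell0 f a fL fp.
pose fk n a s := f s * vp_kernel ell n (s - a).
have cfk n a : continuous (fk n a).
  by move=> x; apply: cvgM; [exact: nonexpansive_continuous|exact: vp_kernel_shift_continuous].
have cfkB n a b : continuous (fun s => fk n a s - fk n b s).
  by move=> x; apply: cvgB; exact: cfk.
have cfkZ n a b c : continuous (fun s => c * (fk n a s - fk n b s)).
  by move=> x; apply: cvgM; [exact: cvg_cst|exact: cfkB].
pose I n a := \int[mu]_(s in `[0, ell]) (f s * vp_kernel ell n (s - a)).
have E n : dirichlet f (tent n a0 a1 b0 b1) =
   (I n a1 - I n a0) / (a1 - a0) - (I n b1 - I n b0) / (b1 - b0).
  rewrite /dirichlet derive2_tent.
  rewrite (@eq_Rintegral _ _ _ mu _ (fun s => (a1 - a0)^-1 * (fk n a0 s - fk n a1 s) -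
     (b1 - b0)^-1 * (fk n b0 s - fk n b1 s))); last first.
    by move=> s _; rewrite /fk; ring.
  rewrite RintegralB//; [|exact: continuous_integrable_itv..].
  rewrite !RintegralZl//; [|exact: continuous_integrable_itv..].
  rewrite !RintegralB//; [|exact: continuous_integrable_itv..].
  rewrite -/(I n a0) -/(I n a1) -/(I n b0) -/(I n b1).
  by move: (I n a0) (I n a1) (I n b0) (I n b1) => ? ? ? ?; ring.
under eq_fun do rewrite E.
apply: cvgB; apply: cvgM; [|exact: cvg_cst| |exact: cvg_cst];
  by apply: cvgB; exact: K.
Qed.

End TestFunctions.

(** * One-sided oscillation of difference quotients *)

Section Oscillation.
Context {R : realType}.
Variable ell : R.
Hypothesis ell0 : 0 < ell.

Definition open_side (s d x y : R) := s < x /\ y < s + d \/ s - d < x /\ y < s.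

Definition closed_side (s d x y : R) := s <= x /\ y < s + d \/ s - d < x /\ y <= s.

(** If the slopes of f oscillated by eta on intervals arbitrarily close to s0
    on one side, one could stack N tents over disjoint intervals accumulating
    at s0. Their sum is bounded by 1 while its pairing with f is, in the
    limit, at least N * eta, against the bound C. This is the part of the theory of functions
    of bounded variation that is needed: the derivative of f has one-sided
    limits at s0, in the strong sense of limits of slopes. *)
Lemma slope_oscillation (f : R -> R) (C : R) : nonexpansive f -> periodic f ell ->
  (forall psi M, test_function ell psi -> (forall s, `|psi s| <= M) -> dirichlet ell f psi <= C * M) ->
  forall s0 eta, 0 < eta -> exists2 del, 0 < del &
    forall c d a0 a1 b0 b1, open_side s0 del c d ->
      c <= a0 -> a0 < a1 -> a1 <= d -> c <= b0 -> b0 < b1 -> b1 <= d ->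
      slope f a0 a1 - slope f b0 b1 <= eta.
Proof.
move=> fL fp fC s0 eta eta0; apply: contrapT => noosc.
have cf := nonexpansive_continuous fL.
have osc del : 0 < del -> exists c d a0 a1 b0 b1,
    [/\ open_side s0 del c d, [/\ c <= a0, a0 < a1 & a1 <= d],
        [/\ c <= b0, b0 < b1 & b1 <= d] & eta < slope f a0 a1 - slope f b0 b1].
  move=> del0; apply: contrapT => H; apply: noosc; exists del => //.
  move=> c d a0 a1 b0 b1 cd ca a01 ad cb b01 bd; rewrite leNgt; apply/negP => lt.
  by apply: H; exists c, d, a0, a1, b0, b1.
pose st := vp_step ell.
(* A smoothed indicator of the set d <= |s - s0| <= d0. *)
pose ann n d d0 s := st n (s - (s0 - d0)) - st n (s - (s0 - d)) +
   (st n (s - (s0 + d)) - st n (s - (s0 + d0))).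
have stnd n (s x y : R) : x <= y -> st n (s - y) <= st n (s - x).
  by move=> xy; apply: vp_step_nd => //; rewrite lerD2l lerN2.
have main N : exists del (psi : nat -> R -> R) v,
   [/\ 0 < del, del <= ell / 2, forall n, test_function ell (psi n),
      forall n s, `|psi n s| <= ann n del (ell / 2) s &
      dirichlet ell f (psi n) @[n --> \oo] --> v /\ N%:R * eta <= v].
  elim: N => [|N [del [psi [v [del0 delell tpsi psiM [psiv vN]]]]]].
    exists (ell / 2), (fun _ _ => 0), 0; split => //.
    - by rewrite divr_gt0.
    - by move=> n; exact: test_function0.
    - by move=> n s; rewrite normr0 /ann !subrr addr0.
    - split; last by rewrite mul0r.
      by under eq_fun do rewrite dirichlet0//; exact: cvg_cst.
  have [c [d [a0 [a1 [b0 [b1 [side [ca a01 ad] [cb b01 bd] sl]]]]]]] := osc _ del0.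
  have cd : c <= d by lra.
  have [del' [del'0 del'del H]] : exists del', [/\ 0 < del', del' <= del &
      forall n s, st n (s - c) - st n (s - d) <= ann n del' del s].
    case: side => -[c1 d1].
      exists (c - s0); split; [lra|lra|] => n s; rewrite /ann.
      have -> : s0 + (c - s0) = c by ring.
      have : s0 - del <= s0 - (c - s0) by lra.
      move=> /(stnd n s); have := stnd n s _ _ (ltW d1); lra.
    exists (s0 - d); split; [lra|lra|] => n s; rewrite /ann.
    have -> : s0 - (s0 - d) = d by ring.
    have : s0 + (s0 - d) <= s0 + del by lra.
    move=> /(stnd n s); have := stnd n s _ _ (ltW c1); lra.
  exists del', (fun n s => psi n s + tent ell n a0 a1 b0 b1 s),
    (v + (slope f a0 a1 - slope f b0 b1)); split => //.
  - exact: le_trans delell.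
  - by move=> n; apply: test_function_add => //; exact: test_function_tent.
  - move=> n s; rewrite (le_trans (ler_normD _ _))//.
    have := psiM n s; have := H n s.
    have := tent_bound ell0 n s a01 b01 ca ad cb bd; rewrite -/st /ann; lra.
  - split; last by rewrite -natr1 mulrDl mul1r; lra.
    have E n : dirichlet ell f (fun s => psi n s + tent ell n a0 a1 b0 b1 s) =
        dirichlet ell f (psi n) + dirichlet ell f (tent ell n a0 a1 b0 b1).
      rewrite dirichlet_add//; first by case: (tpsi n).
      by case: (test_function_tent ell0 n a01 b01).
    under eq_fun do rewrite E.
    by apply: cvgD => //; exact: dirichlet_tent_cvg.
have ann1 n d s : 0 < d -> ann n d (ell / 2) s <= 1.
  move=> d0; have : s0 - d <= s0 + d by lra.
  move=> /(stnd n s); rewrite /ann.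
  have -> : s - (s0 - ell / 2) = s - (s0 + ell / 2) + ell by field.
  rewrite /st vp_stepD//; lra.
have vC N : N%:R * eta <= C.
  have [del [psi [v [del0 delell tpsi psiM [psiv vN]]]]] := main N.
  apply: le_trans vN _; apply: (cvgr_to_le psiv).
  apply: nearW => n; rewrite -[C]mulr1; apply: fC => // s.
  exact: le_trans (psiM n s) (ann1 _ _ _ del0).
have C0 : 0 <= C / eta by apply: divr_ge0; [have := vC 0; rewrite mul0r|exact: ltW].
have := vC (Num.Def.archi_bound (C / eta)).
by rewrite -ler_pdivlMr// leNgt archi_boundP.
Qed.

End Oscillation.

(** * Strict differentiability *)

Section StrictC1.
Context {R : realType}.

Lemma slope_sym (f : R -> R) a b : slope f a b = slope f b a.
Proof. by rewrite /slope -(opprB (f a)) -(opprB a) invrN mulrNN. Qed.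

Lemma slope_shift_cvg (g : R -> R) a b : continuous g ->
  slope g (a + e) (b + e) @[e --> 0] --> slope g a b.
Proof.
move=> cg; rewrite /slope.
have sh c : g (c + e) @[e --> 0] --> g c.
  rewrite -[in X in _ --> X](addr0 c); apply: continuous_cvg; first exact: cg.
  by apply: cvgD; [exact: cvg_cst|exact: cvg_id].
have bE e : b + e - (a + e) = b - a by ring.
under eq_fun do rewrite bE.
apply: cvgM; last exact: cvg_cst.
by apply: cvgB; exact: sh.
Qed.

Lemma slope_across (g : R -> R) lo hi a c b : a < c -> c < b ->
  lo <= slope g a c <= hi -> lo <= slope g c b <= hi -> lo <= slope g a b <= hi.
Proof.
move=> ac cb; have ab : a < b by exact: lt_trans cb.
rewrite /slope !ler_pdivlMr ?subr_gt0// !ler_pdivrMr ?subr_gt0//.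
move=> /andP[? ?] /andP[? ?]; apply/andP; split; lra.
Qed.

(** Nearby difference quotients, even at different base points, are close to
    one common value; hence they are Cauchy at each point and the limits vary
    continuously. *)
Lemma strict_C1 (f : R -> R) :
  (forall s eta : R, 0 < eta -> exists2 del : R, 0 < del & forall a b c d : R,
     s - del < a -> a < b -> b < s + del ->
     s - del < c -> c < d -> d < s + del ->
     `|slope f a b - slope f c d| <= eta) ->
  (forall s : R, derivable f s 1) /\ continuous (derive1 f).
Proof.
move=> H.
have H' (s eta : R) : 0 < eta -> exists2 del : R, 0 < del & exists v : R, forall t : R,
    s - del < t < s + del -> \forall h \near (0 : R)^',
    `|v - h^-1 *: (f (h *: 1 + t) - f t)| <= eta.
  move=> /(H s)[del del0 Hd]; exists del => //.
  exists (slope f (s - del / 2) (s + del / 2)) => t /andP[t1 t2].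
  pose r := Num.min (t - (s - del)) (s + del - t).
  have r0 : 0 < r by rewrite lt_min; lra.
  have : \forall h \near (0 : R)^', `|h| < r.
    by apply: dnbhs0_lt.
  have : \forall h \near (0 : R)^', h != 0 by exact: nbhs_dnbhs_neq.
  apply: filterS2 => h h0.
  rewrite lt_min !ltr_norml => /andP[/andP[h1 h2] /andP[h3 h4]].
  rewrite distrC.
  have -> : h^-1 *: (f (h *: 1 + t) - f t) = slope f t (t + h).
    have hE : t + h - t = h by ring.
    by rewrite /slope /GRing.scale/= mulr1 hE mulrC (addrC h t).
  have [hp|hn|/esym h00] := ltgtP h 0; last by rewrite h00 eqxx in h0.
    by rewrite slope_sym; apply: Hd; lra.
  by apply: Hd; lra.
have df (s : R) : derivable f s 1.
  apply/cauchy_cvgP/cauchy_exP => _/posnumP[e].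
  have e20 : 0 < e%:num / 2 by [].
  have [del del0 [v Hv]] := H' s _ e20.
  exists v; have := Hv s; rewrite ltrBlDr ltrDl del0 => /(_ isT).
  by apply: filterS => h /le_lt_trans; apply; rewrite ltr_pdivrMr// ltr_pMr ?ltr1n.
split; first exact: df.
move=> s; apply/cvgrPdist_le => e e0.
have e20 : 0 < e / 2 by rewrite divr_gt0.
have [del del0 [v Hv]] := H' s _ e20.
have Hd t : s - del < t < s + del -> `|v - derive1 f t| <= e / 2.
  move=> /Hv Ht; have := df t; rewrite derive1E => cvt.
  have : `|v - h^-1 *: (f (h *: 1 + t) - f t)| @[h --> 0^'] --> `|v - 'D_1 f t|.
    by apply: cvg_norm; apply: cvgB; [exact: cvg_cst|exact: cvt].
  by move/cvgr_to_le; apply.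
have Hs : `|v - derive1 f s| <= e / 2 by apply: Hd; rewrite ltrBlDr ltrDl del0.
have : \forall t \near s, t \in `]s - del, s + del[.
  by apply: near_in_itvoo; rewrite in_itv/= ltrBlDr ltrDl del0.
apply: filterS => t; rewrite in_itv/= => /Hd Ht.
have -> : derive1 f s - derive1 f t = - (v - derive1 f s) + (v - derive1 f t) by ring.
by rewrite (le_trans (ler_normD _ _))// normrN; lra.
Qed.

End StrictC1.

(** * Euclidean geometry of three-space *)

Section Euclid.
Context {R : realType}.
Implicit Types u v w : 'rV[R]_3.

Definition norm3 u : R := Num.sqrt (dot3 u u).

Lemma edist3E u v : edist3 u v = norm3 (u - v).
Proof. by []. Qed.

Lemma dot3C u v : dot3 u v = dot3 v u.
Proof. by apply: eq_bigr => k _; rewrite mulrC. Qed.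

Lemma dot3Dl u v w : dot3 (u + v) w = dot3 u w + dot3 v w.
Proof. by rewrite -big_split; apply: eq_bigr => k _; rewrite mxE mulrDl. Qed.

Lemma dot3Dr u v w : dot3 w (u + v) = dot3 w u + dot3 w v.
Proof. by rewrite dot3C dot3Dl !(dot3C w). Qed.

Lemma dot3Zl c u v : dot3 (c *: u) v = c * dot3 u v.
Proof. by rewrite /dot3 mulr_sumr; apply: eq_bigr => k _; rewrite mxE mulrA. Qed.

Lemma dot3Zr c u v : dot3 v (c *: u) = c * dot3 v u.
Proof. by rewrite dot3C dot3Zl dot3C. Qed.

Lemma dot3Nl u v : dot3 (- u) v = - dot3 u v.
Proof. by rewrite -scaleN1r dot3Zl mulN1r. Qed.

Lemma dot3Nr u v : dot3 v (- u) = - dot3 v u.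
Proof. by rewrite dot3C dot3Nl dot3C. Qed.

Lemma dot3_ge0 u : 0 <= dot3 u u.
Proof. by apply: sumr_ge0 => k _; rewrite -expr2 sqr_ge0. Qed.

Lemma sqr_norm3 u : norm3 u ^+ 2 = dot3 u u.
Proof. by rewrite sqr_sqrtr// dot3_ge0. Qed.

Lemma norm3_ge0 u : 0 <= norm3 u. Proof. exact: sqrtr_ge0. Qed.

Lemma CauchySchwarz3 u v : dot3 u v <= norm3 u * norm3 v.
Proof.
have H : dot3 u v ^+ 2 <= (norm3 u * norm3 v) ^+ 2.
  rewrite exprMn !sqr_norm3 /dot3 !big_ord_recl !big_ord0.
  set a := u _ _; set b := u _ _; set c := u _ _.
  set d := v _ _; set e := v _ _; set f := v _ _.
  have := sqr_ge0 (a * e - b * d); have := sqr_ge0 (a * f - c * d).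
  have := sqr_ge0 (b * f - c * e); nra.
apply: le_trans (ler_norm _) _.
by rewrite -(ler_pXn2r (n := 2))// ?nnegrE ?mulr_ge0 ?norm3_ge0// real_normK// num_real.
Qed.

Lemma norm3D u v : norm3 (u + v) <= norm3 u + norm3 v.
Proof.
rewrite -(ler_pXn2r (n := 2))// ?nnegrE ?addr_ge0 ?norm3_ge0//.
rewrite sqrrD !sqr_norm3 !dot3Dl !dot3Dr (dot3C v u).
have := CauchySchwarz3 u v; rewrite mulr2n; lra.
Qed.

Lemma norm3N u : norm3 (- u) = norm3 u.
Proof. by rewrite /norm3 dot3Nl dot3Nr opprK. Qed.

Lemma norm3Z c u : norm3 (c *: u) = `|c| * norm3 u.
Proof.
by rewrite /norm3 dot3Zl dot3Zr mulrA -expr2 sqrtrM ?sqr_ge0// sqrtr_sqr.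
Qed.

Lemma norm3_geB u v : norm3 u - norm3 v <= norm3 (u + v).
Proof. by have := norm3D (u + v) (- v); rewrite addrK norm3N lerBlDr. Qed.

Lemma coord_le_norm3 u k : `|u 0 k| <= norm3 u.
Proof.
rewrite -sqrtr_sqr ler_sqrt ?dot3_ge0// /dot3 (bigD1 k)//= -expr2 lerDl.
by apply: sumr_ge0 => j _; rewrite -expr2 sqr_ge0.
Qed.

Lemma edist3C u v : edist3 u v = edist3 v u.
Proof. by rewrite !edist3E -norm3N opprB. Qed.

End Euclid.

(** * Link-thickness and fields moving one component *)

Section Thickness.
Context {R : realType} {m : nat}.
Implicit Types (ell : 'I_m -> R) (L xi : 'I_m -> R -> 'rV[R]_3).

Let dists L := [set d | exists i j s t, i != j /\ d = edist3 (L i s) (L j t)].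

Lemma LThi_ge0 L : 0 <= LThi L.
Proof.
rewrite /LThi -/(dists L).
have [E0|/set0P E] := eqVneq (dists L) set0; first by rewrite E0 inf0.
by apply: lb_le_inf => // _ [i [j [s [t [_ ->]]]]]; exact: norm3_ge0.
Qed.

Lemma LThi_le L i j s t : i != j -> LThi L <= edist3 (L i s) (L j t).
Proof.
move=> ij; apply: ge_inf; last by exists i, j, s, t.
by exists 0 => _ [i' [j' [s' [t' [_ ->]]]]]; exact: norm3_ge0.
Qed.

(** When there are fewer than two components both infima are 0 by convention,
    which is why c >= 0 is assumed. *)
Lemma LThi_lower L L' c : 0 <= c ->
  (forall i j s t, i != j -> LThi L - c <= edist3 (L' i s) (L' j t)) ->
  LThi L - c <= LThi L'.
Proof.
move=> c0 H; rewrite {2}/LThi -/(dists L').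
have [E0|/set0P E] := eqVneq (dists L') set0; last first.
  by apply: lb_le_inf => // _ [i [j [s [t [ij ->]]]]]; exact: H.
suff -> : LThi L = 0 by rewrite E0 inf0 sub0r oppr_le0.
rewrite /LThi -/(dists L).
have [->|/set0P[_ [i [j [s [t [ij _]]]]]]] := eqVneq (dists L) set0; first exact: inf0.
suff : dists L' (edist3 (L' i s) (L' j t)) by rewrite E0.
by exists i, j, s, t.
Qed.

Definition component_field (i : 'I_m) (psi : R -> R) (w : 'rV[R]_3) : 'I_m -> R -> 'rV[R]_3 :=
  fun j s => if j == i then psi s *: w else 0.

Lemma LThi_component_field L i psi w t c : 0 <= c ->
  (forall j s s', j != i -> LThi L - c <= edist3 (L i s + (t * psi s) *: w) (L j s')) ->
  LThi L - c <= LThi (fun j s => L j s + t *: component_field i psi w j s).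
Proof.
move=> c0 H; apply: LThi_lower => // j k s s' jk; rewrite /component_field.
have [jE|ji] := eqVneq j i; have [kE|ki] := eqVneq k i.
- by rewrite jE kE eqxx in jk.
- by rewrite jE scaler0 addr0 scalerA; exact: H.
- by rewrite kE scaler0 addr0 scalerA edist3C; exact: H.
- rewrite !scaler0 !addr0; apply: le_trans (LThi_le L s s' jk).
  by rewrite lerBlDr lerDl.
Qed.

End Thickness.

(** * First variation of length along a one-component field *)

Section Fields.
Context {R : realType} {m : nat}.
Local Notation mu := (@lebesgue_measure R).
Implicit Types (ell : 'I_m -> R) (L xi : 'I_m -> R -> 'rV[R]_3).

Lemma derive1_vec (psi : R -> R) (w : 'rV[R]_3) : (forall s : R, derivable psi s 1) ->
  (forall s : R, derivable (fun s => psi s *: w) s 1) /\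
  derive1 (fun s => psi s *: w) = (fun s => derive1 psi s *: w).
Proof.
move=> dpsi.
have dc (i : 'I_1) (j : 'I_3) (s : R) :
    is_derive s 1 (fun s => (psi s *: w) i j) (derive1 psi s * w i j).
  under eq_fun do rewrite mxE.
  have H : is_derive s 1 psi (derive1 psi s).
    by apply: DeriveDef; [exact: dpsi|rewrite derive1E].
  by apply: is_derive_eq; rewrite /GRing.scale/=; ring.
have dv (s : R) : derivable (fun s => psi s *: w) s 1.
  by apply/derivable_mxP => i j; apply: ex_derive.
split => //; apply/funext => s; rewrite derive1E derive_mx//.
by apply/matrixP => i j; rewrite mxE derive_val mxE.
Qed.

Lemma derive1n_vec (psi : R -> R) (w : 'rV[R]_3) n : elementary psi ->
  derive1n n (fun s => psi s *: w) = (fun s => derive1n n psi s *: w).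
Proof.
move=> e; elim: n => [//|n IH]; rewrite derive1nS IH.
by have [_ ->] := derive1_vec w (@elementary_smooth R psi e n); rewrite derive1nS.
Qed.

Lemma smooth_component_field ell i psi w : test_function (ell i) psi -> smooth_vector_field ell (component_field i psi w).
Proof.
move=> [e p] j; rewrite /component_field; have [->|ji] := eqVneq j i.
  split; first by move=> s; rewrite p.
  move=> n s; rewrite derive1n_vec//.
  by have [H _] := derive1_vec w (@elementary_smooth R psi e n); exact: H.
split => // n s.
have -> : (fun=> 0 : 'rV[R]_3) = (fun s : R => 0 *: (0 : 'rV[R]_3)).
  by apply/funext => ?; rewrite scaler0.
rewrite derive1n_vec; last exact: elementary_cst.
by have [H _] := derive1_vec (0 : 'rV[R]_3) (@elementary_smooth R _ (elementary_cst 0) n); exact: H.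
Qed.

Lemma periodic_derive1 (psi : R -> R) l : elementary psi -> periodic psi l ->
  periodic (derive1 psi) l.
Proof.
move=> e p s.
have H := is_derive_shift (- l) (is_derive_elementary e) s.
rewrite opprK in H; rewrite -(@derive_val _ _ _ _ _ _ _ H) derive1E; congr ('D_1 _ s).
by apply/funext => x; rewrite ?opprK p.
Qed.

Lemma Rintegral_sum3 (c : 'I_3 -> R) (D : set R) (F : 'I_3 -> R -> R) : measurable D ->
  (forall k, mu.-integrable D (EFin \o F k)) ->
  \int[mu]_(x in D) (\sum_k c k * F k x) = \sum_k c k * \int[mu]_(x in D) F k x.
Proof.
move=> mD iF.
have icF k : mu.-integrable D (EFin \o (fun x => c k * F k x)).
  have -> : EFin \o (fun x => c k * F k x) = (fun x => ((c k)%:E * (EFin \o F k) x)%E).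
    by apply/funext => x.
  exact: integrableZl.
rewrite !big_ord_recl big_ord0 addr0 -!RintegralZl//.
set k0 := ord0; set k1 := lift _ _; set k2 := lift _ _.
have i12 : mu.-integrable D (EFin \o (fun x => c k1 * F k1 x + c k2 * F k2 x)).
  have -> : EFin \o (fun x => c k1 * F k1 x + c k2 * F k2 x) =
    ((EFin \o (fun x => (c k1 * F k1 x)%R)) \+ (EFin \o (fun x => (c k2 * F k2 x)%R)))%E.
    by apply/funext => x.
  exact: integrableD.
rewrite -RintegralD// -RintegralD//; apply: eq_Rintegral => x _.
by rewrite !big_ord_recl big_ord0 addr0.
Qed.

(** Almost everywhere all three coordinates of the curve are differentiable,
    and there the integrand is a combination of products of densities with
    the derivative of psi, each of which can be integrated by parts. *)
Lemma deltaLen_component_field ell L i psi w : 0 < ell i ->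
  periodic (L i) (ell i) ->
  (forall k, nonexpansive (fun s => L i s 0 k)) -> test_function (ell i) psi ->
  delta_Len ell L (component_field i psi w) = \sum_k w 0 k * dirichlet (ell i) (fun s => L i s 0 k) psi.
Proof.
move=> l0 pL fL [e p].
rewrite /delta_Len (bigD1 i)//= [X in _ + X]big1 ?addr0; last first.
  move=> j ji; rewrite (@eq_Rintegral _ _ _ mu _ (fun=> 0)).
    by rewrite Rintegral_cst// mul0r.
  move=> s _; rewrite /component_field (negbTE ji).
  have -> : derive1 (fun=> 0 : 'rV[R]_3) s = 0.
    by rewrite derive1E derive_cst.
  by rewrite dot3C -(scale0r (0 : 'rV[R]_3)) dot3Zl mul0r.
have -> : component_field i psi w i = (fun s => psi s *: w) by apply/funext => s; rewrite /component_field eqxx.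
have [_ dE] := derive1_vec w (@elementary_smooth R psi e 0).
rewrite {}dE.
pose f k s := L i s 0 k.
have parts k : exists g : R -> R,
    {ae mu, forall x, 0 <= x <= ell i -> derivable (f k) x 1 /\ derive1 (f k) x = g x} /\
    mu.-integrable `[0, ell i] (EFin \o (fun x => g x * derive1 psi x)) /\
    \int[mu]_(x in `[0, ell i]) (g x * derive1 psi x) = dirichlet (ell i) (f k) psi.
  have [g [gae gP]] := nonexpansive_parts (fL k) l0.
  have e1 := elementary_derive1 e.
  have [ig igE] := gP _ _ (is_derive_elementary e1) (elementary_continuous (elementary_derive1 e1)).
  exists g; split => //; split => //.
  rewrite igE /dirichlet -[in LHS](add0r (ell i)) pL (periodic_derive1 e p) subrr add0r.
  by rewrite add0r.
have [g gP] := choice parts.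
rewrite (@Rintegral_ae_eq _ _ _ mu _ _ (fun s => \sum_k w 0 k * (g k s * derive1 psi s))).
  rewrite (Rintegral_sum3 (fun k => w 0 k) (F := fun k s => g k s * derive1 psi s)) //.
    by apply: eq_bigr => k _; have [_ [_ ->]] := gP k.
  by move=> k; have [_ []] := gP k.
have : {ae mu, forall x k, 0 <= x <= ell i -> derivable (f k) x 1 /\ derive1 (f k) x = g k x}.
  apply: (@filter_forall _ _ _ _ (ae_filter_ringOfSetsType mu)) => k.
  by have [] := gP k.
apply: (@filterS _ _ (ae_filter_ringOfSetsType mu)).
move=> s H /=; rewrite in_itv/= => sI.
have dL : derivable (L i) s 1.
  by apply/derivable_mxP => a b; rewrite (ord1 a); have [] := H b sI.
rewrite /dot3 derive1E derive_mx//; apply: eq_bigr => k _.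
rewrite !mxE -derive1E; have [_ ->] := H k sI; ring.
Qed.

End Fields.

(** * Arclength parametrization *)

Section Arclength.
Context {R : realType} {m : nat}.
Implicit Types L : 'I_m -> R -> 'rV[R]_3.

(** The chord is an inscribed polygon with one edge. *)
Lemma arclength_lip L i x y : arclength_parametrized L ->
  norm3 (L i x - L i y) <= `|x - y|.
Proof.
move=> aL; wlog yx : x y / y <= x.
  move=> H; have [/H//|/ltW/H] := leP y x.
  by rewrite -norm3N opprB distrC.
rewrite ger0_norm ?subr_ge0//; move: yx; rewrite le_eqVlt => /predU1P[->|yx].
  by rewrite !subrr /norm3 -(scale0r (0 : 'rV[R]_3)) dot3Zl mul0r sqrtr0.
rewrite -lee_fin -(aL i y x (ltW yx)); apply: ereal_sup_ubound.
exists [:: x]; first by split => //=; rewrite yx.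
by rewrite /= big_nat1.
Qed.

Lemma arclength_nonexpansive L i k : arclength_parametrized L -> nonexpansive (fun s => L i s 0 k).
Proof.
move=> aL x y; apply: le_trans (arclength_lip i x y aL).
by have := coord_le_norm3 (L i x - L i y) k; rewrite !mxE.
Qed.

End Arclength.

(** * Pushing a corner inwards *)

Section CornerPush.
Context {R : realType}.

(** The curve has a corner at x0, with incoming chord B and outgoing chord A of
    length at most u, and x is a point near x0, both seen from a point of another
    component at the origin. Since the chord endpoints keep distance tau from
    the origin, the inner product of x0 with A - B is nearly nonnegative when
    x0 is at distance about tau. Moving x in the direction of A - B, by which
    the length decreases to first order, therefore hardly decreases its
    distance to the origin. *)
Lemma corner_push (x x0 A B : 'rV[R]_3) (tau u h t rho : R) :
  0 < tau -> 0 < u -> 0 < h -> 3 * h * (2 * tau + 3 * h) + 4 * h * u <= u ^+ 2 ->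
  norm3 A <= u -> norm3 B <= u -> tau <= norm3 x -> norm3 (x - x0) <= 2 * h ->
  tau <= norm3 (x0 + A) -> tau <= norm3 (x0 - B) ->
  0 <= rho -> rho <= t -> 2 * t <= h ->
  tau - t * (2 * u / tau) <= norm3 (x + rho *: (u^-1 *: (A - B))).
Proof.
move=> tau0 u0 h0 hu Au Bu taux xx0 tauA tauB rho0 rhot th.
set w := u^-1 *: (A - B).
have wu : u *: w = A - B by rewrite scalerA mulfV ?gt_eqF// scale1r.
have nw : norm3 w <= 2.
  rewrite norm3Z gtr0_norm ?invr_gt0// ler_pdivrMl//.
  by have := norm3D A (- B); rewrite norm3N; lra.
have q0 : 0 <= t * (2 * u / tau).
  apply: mulr_ge0; first exact: le_trans rhot.
  by apply: divr_ge0; [apply: mulr_ge0|]; rewrite ?ltW.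
have [xbig|xsmall] := leP (tau + h) (norm3 x).
  have := norm3_geB x (rho *: w); rewrite norm3Z ger0_norm//.
  have : rho * norm3 w <= t * 2 by apply: ler_pM => //; exact: norm3_ge0.
  lra.
have sq (a b : R) : 0 <= a -> a <= b -> a ^+ 2 <= b ^+ 2.
  by move=> a0 ab; nra.
have nx0 : norm3 x0 <= tau + 3 * h.
  have := norm3D x (- (x - x0)); rewrite norm3N opprB addrC subrK; lra.
have x0w : - (3 * h * (2 * tau + 3 * h)) - u ^+ 2 <= u * dot3 x0 w.
  rewrite -dot3Zr wu.
  have := sq _ _ (ltW tau0) tauA; have := sq _ _ (ltW tau0) tauB.
  have := sq _ _ (norm3_ge0 A) Au; have := sq _ _ (norm3_ge0 B) Bu.
  have := sq _ _ (norm3_ge0 x0) nx0.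
  rewrite !sqr_norm3 !dot3Dl !dot3Dr !dot3Nl !dot3Nr (dot3C A x0) (dot3C B x0); nra.
have xw : - (2 * u) <= dot3 x w.
  have d1 : dot3 x w = dot3 x0 w + dot3 (x - x0) w.
    by rewrite -dot3Dl addrC subrK.
  have d2 : - (4 * h) <= dot3 (x - x0) w.
    have := CauchySchwarz3 (- (x - x0)) w; rewrite norm3N dot3Nl.
    have : norm3 (x - x0) * norm3 w <= 2 * h * 2.
      by apply: ler_pM => //; exact: norm3_ge0.
    lra.
  rewrite -(ler_pM2l u0) d1; nra.
have nx0' : 0 < norm3 x by exact: lt_le_trans taux.
have : norm3 x * (norm3 x - 2 * u * rho / norm3 x) <= norm3 x * norm3 (x + rho *: w).
  rewrite mulrBr mulrCA mulfV ?gt_eqF// mulr1 -expr2 sqr_norm3 [leRHS]mulrC.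
  apply: (le_trans _ (CauchySchwarz3 _ _)); rewrite dot3Dl dot3Zl (dot3C w).
  nra.
rewrite ler_pM2l// => /(le_trans _); apply.
have : 2 * u * rho / norm3 x <= t * (2 * u / tau).
  rewrite ler_pdivrMr//.
  have -> : t * (2 * u / tau) * norm3 x = (2 * u * t) * (norm3 x / tau) by ring.
  rewrite -[leLHS]mulr1; apply: ler_pM => //.
  - by rewrite mulr_ge0// mulr_ge0// ltW.
  - by rewrite ler_pM2l// mulr_gt0.
  - by rewrite ler_pdivlMr// mul1r.
lra.
Qed.

End CornerPush.

(** * Strongly critical links *)

Section CriticalRegularity.
Context {R : realType} {m : nat}.
Variables (ell : 'I_m -> R) (L : 'I_m -> R -> 'rV[R]_3).
Hypothesis Lrect : rectifiable_link ell L.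

Let ell0 i : 0 < ell i. Proof. by case: Lrect => -[]. Qed.
Let Lper i : periodic (L i) (ell i). Proof. by case: Lrect => -[]. Qed.
Let Larc : arclength_parametrized L. Proof. by case: Lrect. Qed.

Let f i k s : R := L i s 0 k.
Let fL i k : nonexpansive (f i k). Proof. exact: arclength_nonexpansive. Qed.
Let fp i k : periodic (f i k) (ell i).
Proof. by move=> s; rewrite /f Lper. Qed.

Variable eps : R.
Hypothesis eps0 : 0 < eps.
Hypothesis Lcrit : forall xi, smooth_vector_field ell xi ->
  delta_Len ell L xi = -1 -> delta_plus_LThi L xi <= - eps.

(** A divergent difference quotient has limit 0 by convention, which is not
    below - eps; hence criticality forces convergence, and any lower bound on
    the difference quotients bounds the limit. Rescaling the field to unit
    first variation turns this into a bound by kap / eps. *)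
Lemma critical_bound i psi w kap t0 : test_function (ell i) psi -> 0 <= kap -> 0 < t0 ->
  (forall t, 0 < t -> t < t0 ->
     LThi L - t * kap <= LThi (fun j s => L j s + t *: component_field i psi w j s)) ->
  - (\sum_k w 0 k * dirichlet (ell i) (f i k) psi) <= kap / eps.
Proof.
move=> tpsi kap0 t00 Ht.
set c := - _; have [c0|c0] := leP c 0.
  by rewrite (le_trans c0)// divr_ge0// ltW.
have tcpsi : test_function (ell i) (fun s => c^-1 * psi s) by exact: test_function_scale.
have component_fieldE j s : component_field i (fun s => c^-1 * psi s) w j s = c^-1 *: component_field i psi w j s.
  by rewrite /component_field; case: eqP => _; rewrite ?scaler0// scalerA.
have dlen : delta_Len ell L (component_field i (fun s => c^-1 * psi s) w) = -1.
  rewrite deltaLen_component_field//; last by move=> k; exact: fL.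
  have cf k := nonexpansive_continuous (fL i k).
  have -> : \sum_k w 0 k * dirichlet (ell i) (fun s => L i s 0 k) (fun s => c^-1 * psi s)
     = c^-1 * \sum_k w 0 k * dirichlet (ell i) (f i k) psi.
    rewrite mulr_sumr; apply: eq_bigr => k _.
    by rewrite dirichlet_scale; [rewrite mulrCA|exact: cf|case: tpsi].
  by rewrite -[X in _ * X]opprK -/c mulrN mulVf ?gt_eqF.
have := Lcrit (smooth_component_field w tcpsi) dlen.
rewrite /delta_plus_LThi.
set q := (X in lim X).
have [cq|/dvgP ->] := pselect (cvg q); last first.
  rewrite /point/= lerNr oppr0 leNgt; by rewrite eps0.
move=> lq; have : - kap / c <= lim q.
  apply: limr_ge => //.
  have t0c : 0 < t0 * c by rewrite mulr_gt0.
  have := nbhs_right_lt t0c; have : \forall t \near (0 : R)^'+, 0 < t by exact: nbhs_right_gt.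
  apply: filterS2 => t t1 t2.
  have tc0 : 0 < t / c by rewrite divr_gt0.
  have tct : t / c < t0 by rewrite ltr_pdivrMr.
  have := Ht _ tc0 tct.
  have -> : (fun j s => L j s + (t / c) *: component_field i psi w j s) =
    (fun j s => L j s + t *: component_field i (fun s => c^-1 * psi s) w j s).
    by apply/funext => j; apply/funext => s; rewrite component_fieldE scalerA.
  move=> H; rewrite [leRHS]mulrC ler_pdivlMr//.
  have -> : - kap / c * t = - (t / c * kap) by rewrite mulrAC; ring.
  by rewrite lerBrDr addrC.
move=> /le_trans/(_ lq); rewrite ler_pdivrMr// mulNr lerN2.
by rewrite ler_pdivlMr// mulrC.
Qed.

(** Moving points by at most M decreases the thickness at rate at most M, so
    the derivative of a strongly critical link has bounded variation. *)
Lemma variation_bound i k psi M : test_function (ell i) psi -> (forall s, `|psi s| <= M) ->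
  dirichlet (ell i) (f i k) psi <= eps^-1 * M.
Proof.
move=> tpsi psiM; have M0 : 0 <= M by exact: le_trans (psiM 0).
pose w : 'rV[R]_3 := - delta_mx 0 k.
have nw : norm3 w = 1.
  rewrite norm3N /norm3 /dot3 (bigD1 k)//= big1 ?addr0 => [|j jk].
    by rewrite !mxE !eqxx mulr1 sqrtr1.
  by rewrite !mxE eqxx (negbTE jk) mulr0.
have -> : dirichlet (ell i) (f i k) psi = - (\sum_j w 0 j * dirichlet (ell i) (f i j) psi).
  rewrite (bigD1 k)//= big1 ?addr0 => [|j jk].
    by rewrite !mxE !eqxx mulN1r opprK.
  by rewrite !mxE eqxx (negbTE jk) oppr0 mul0r.
rewrite mulrC; apply: (critical_bound tpsi M0 (ltr01)) => t t0 _.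
apply: LThi_component_field => [|j s s' ji]; first by rewrite mulr_ge0// ltW.
rewrite edist3E addrAC.
apply: le_trans (norm3_geB _ _); rewrite norm3Z nw mulr1 normrM gtr0_norm//.
by rewrite lerB// ?ler_pM2l// -edist3E LThi_le// eq_sym.
Qed.

(** The end point s0 is reached by continuity of the curve, translating all
    intervals slightly away from s0. *)
Lemma closed_oscillation i s0 eta : 0 < eta -> exists2 del, 0 < del &
  forall k c d a0 a1 b0 b1, closed_side s0 del c d ->
    c <= a0 -> a0 < a1 -> a1 <= d -> c <= b0 -> b0 < b1 -> b1 <= d ->
    slope (f i k) a0 a1 - slope (f i k) b0 b1 <= eta.
Proof.
move=> eta0.
have H k := slope_oscillation (ell0 i) (fL i k) (fp i k) (@variation_bound i k) s0 eta0.
have [del del0 Hd] : exists2 del, 0 < del & forall k c d a0 a1 b0 b1, open_side s0 del c d ->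
    c <= a0 -> a0 < a1 -> a1 <= d -> c <= b0 -> b0 < b1 -> b1 <= d ->
    slope (f i k) a0 a1 - slope (f i k) b0 b1 <= eta.
  have : \forall del \near (0 : R)^'+, forall k c d a0 a1 b0 b1, open_side s0 del c d ->
    c <= a0 -> a0 < a1 -> a1 <= d -> c <= b0 -> b0 < b1 -> b1 <= d ->
    slope (f i k) a0 a1 - slope (f i k) b0 b1 <= eta.
    apply: filter_forall => k; have [del del0 Hd] := H k.
    have := nbhs_right_lt del0; apply: filterS => del' lt c d a0 a1 b0 b1 side.
    by apply: Hd; case: side => -[? ?]; [left|right]; lra.
  have : \forall del \near (0 : R)^'+, 0 < del by exact: nbhs_right_gt.
  by move=> /filterI/[apply] /filter_ex[del [? ?]]; exists del.
exists del => // k c d a0 a1 b0 b1 side ca a01 ad cb b01 bd.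
have cf := nonexpansive_continuous (fL i k).
have C : slope (f i k) (a0 + e) (a1 + e) - slope (f i k) (b0 + e) (b1 + e) @[e --> 0]
   --> slope (f i k) a0 a1 - slope (f i k) b0 b1.
  by apply: cvgB; exact: slope_shift_cvg.
case: side => -[c1 d1].
  have := cvg_at_right_filter C; move/cvgr_to_le; apply.
  have e1 : 0 < s0 + del - d by lra.
  have := nbhs_right_lt e1; have : \forall e \near (0 : R)^'+, 0 < e by exact: nbhs_right_gt.
  apply: filterS2 => e e0 ed; apply: (Hd k (c + e) (d + e)); rewrite ?lerD2r ?ltrD2r//.
  by left; lra.
have := cvg_at_left_filter C; move/cvgr_to_le; apply.
have e1 : s0 - del - c < 0 by lra.
have := nbhs_left_gt e1; have : \forall e \near (0 : R)^'-, e < 0 by exact: nbhs_left_lt.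
apply: filterS2 => e e0 ed; apply: (Hd k (c + e) (d + e)); rewrite ?lerD2r ?ltrD2r//.
by right; lra.
Qed.

(** Move a neighbourhood of s0 of size h << u in the direction w of the
    difference between the outgoing and incoming slopes at scale u. The length
    decreases at a rate close to |w|^2 because, by one-sided oscillation, the
    slopes at scale h agree with those at scale u, whereas by corner_push the
    thickness decreases at a rate of at most about 2 * u / LThi L. If the
    thickness is 0 it cannot decrease, in accordance with the convention
    2 * u / 0 = 0. *)
Lemma corner_estimate i s0 eta del u : 0 < eta ->
  (forall k c d a0 a1 b0 b1, closed_side s0 del c d ->
    c <= a0 -> a0 < a1 -> a1 <= d -> c <= b0 -> b0 < b1 -> b1 <= d ->
    slope (f i k) a0 a1 - slope (f i k) b0 b1 <= eta) ->
  0 < u -> u < del ->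
  \sum_k (slope (f i k) s0 (s0 + u) - slope (f i k) (s0 - u) s0) ^+ 2 <=
  12 * eta + 2 * u / LThi L / eps.
Proof.
move=> eta0 osc u0 udel.
set tau := LThi L.
have tau0 : 0 <= tau by exact: LThi_ge0.
pose A := L i (s0 + u) - L i s0; pose B := L i s0 - L i (s0 - u).
pose w := u^-1 *: (A - B).
have uE1 : s0 + u - s0 = u by ring.
have uE2 : s0 - (s0 - u) = u by ring.
have nA : norm3 A <= u.
  by have := arclength_lip i (s0 + u) s0 Larc; rewrite uE1 gtr0_norm.
have nB : norm3 B <= u.
  by have := arclength_lip i s0 (s0 - u) Larc; rewrite uE2 gtr0_norm.
have nw : norm3 w <= 2.
  rewrite norm3Z gtr0_norm ?invr_gt0// ler_pdivrMl//.
  by have := norm3D A (- B); rewrite norm3N; lra.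
have wE k : w 0 k = slope (f i k) s0 (s0 + u) - slope (f i k) (s0 - u) s0.
  rewrite /w /slope /f !mxE.
  rewrite uE1 uE2; ring.
(* hq makes the error terms of corner_push at most u ^ 2. *)
have [h [h0 hu hl hq]] : exists h, [/\ 0 < h, h < u, h < ell i / 4 &
    3 * h * (2 * tau + 3 * h) + 4 * h * u <= u ^+ 2].
  pose q := 6 * tau + 9 + 4 * u.
  have q0 : 0 < q by rewrite /q; lra.
  pose h := Num.min (Num.min (u / 2) (ell i / 5)) (Num.min 1 (u ^+ 2 / q)).
  have uq : 0 < u ^+ 2 / q by apply: divr_gt0 => //; exact: exprn_gt0.
  have l5 : 0 < ell i / 5 by exact: divr_gt0.
  have h0 : 0 < h by rewrite !lt_min uq l5 ltr01 divr_gt0.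
  have : h <= h by [].
  rewrite {2}/h !le_min => /andP[/andP[h1 h2] /andP[h3]].
  rewrite ler_pdivlMr// => h4.
  exists h; split => //; [lra|have := ell0 i; lra|].
  by move: h4; rewrite /q; nra.
have hl2 : h < ell i / 2 by have := ell0 i; lra.
have [D D0 Dn] := vp_step_flat (ell0 i) h0 hl2.
pose psi n := tent (ell i) n (s0 - h) s0 s0 (s0 + h).
have sh1 : s0 - h < s0 by lra.
have sh2 : s0 < s0 + h by lra.
have tpsi n : test_function (ell i) (psi n) by exact: test_function_tent.
have st n (x y : R) : x <= y -> vp_step (ell i) n x <= vp_step (ell i) n y by exact: vp_step_nd.
have psi0 n s : 0 <= psi n s by exact: tent_ge0.
have psiS n s : psi n s <= vp_step (ell i) n (s - (s0 - h)) - vp_step (ell i) n (s - (s0 + h)).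
  apply: le_trans (ler_norm _) _; apply: tent_bound => //; lra.
have psi1 n s : psi n s <= 1.
  apply: le_trans (psiS n s) _.
  have : s - (s0 - h) <= s - (s0 + h) + ell i by lra.
  by move=> /(st n); rewrite vp_stepD//; lra.
have LD i' j s s' : i' != j -> tau <= norm3 (L i' s - L j s').
  by move=> ij; rewrite -edist3E LThi_le.
(* The first term comes from corner_push near s0, the second one from the
   tail of the smoothed tent away from s0. *)
pose kap n := 2 * u / tau + 2 * (D / (n%:R + 1)).
have DN n : 0 <= D / (n%:R + 1) by apply: divr_ge0 => //; exact: addr_ge0.
have ut0 : 0 <= 2 * u / tau by apply: divr_ge0 => //; apply: mulr_ge0 => //; exact: ltW.
have kap0 n : 0 <= kap n by apply: addr_ge0 => //; exact: mulr_ge0.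
have bound n : - (\sum_k w 0 k * dirichlet (ell i) (f i k) (psi n)) <= kap n / eps.
  have h20 : 0 < h / 2 by rewrite divr_gt0.
  apply: (critical_bound (tpsi n) (kap0 n) h20) => t t0 th.
  have [tauE|tau_neq0] := eqVneq tau 0.
    rewrite -/tau tauE; apply: le_trans (LThi_ge0 _).
    by rewrite sub0r oppr_le0 mulr_ge0// ltW.
  have {tau_neq0}taup : 0 < tau by rewrite lt_neqAle eq_sym tau_neq0.
  apply: LThi_component_field => [|j s s' ji]; first by rewrite mulr_ge0// ltW.
  have ij : i != j by rewrite eq_sym.
  have [k /andP[y0 yl]] := period_reduce (ell0 i) (s - s0 + 2 * h).
  pose y := s - s0 - k%:~R * ell i.
  have yh : - (2 * h) <= y by rewrite /y; lra.
  have yl2 : y < ell i - 2 * h by rewrite /y; lra.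
  have sE : s = s0 + y + k%:~R * ell i by rewrite /y; ring.
  clearbody y; clear y0 yl.
  have LE : L i s = L i (s0 + y).
    by apply/rowP => a; rewrite sE; exact: (periodicz (fp i a)).
  have psiE : psi n s = psi n (s0 + y).
    by rewrite sE; apply: periodicz; case: (tpsi n).
  rewrite edist3E addrAC LE psiE -/tau.
  have rho0 : 0 <= t * psi n (s0 + y) by rewrite mulr_ge0// ltW.
  have [ysmall|ybig] := leP y (2 * h).
    apply: (@le_trans _ _ (tau - t * (2 * u / tau))).
      by rewrite lerB// ler_pM2l// /kap lerDl mulr_ge0.
    apply: (@corner_push _ _ (L i s0 - L j s') A B tau u h) => //.
    - exact: LD.
    - have -> : L i (s0 + y) - L j s' - (L i s0 - L j s') = L i (s0 + y) - L i s0.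
        by rewrite opprB addrA subrK.
      apply: le_trans (arclength_lip i _ _ Larc) _.
      have -> : s0 + y - s0 = y by ring.
      by rewrite ler_norml; lra.
    - have -> : L i s0 - L j s' + A = L i (s0 + u) - L j s'.
        by rewrite /A addrC addrA subrK.
      exact: LD.
    - have -> : L i s0 - L j s' - B = L i (s0 - u) - L j s'.
        by apply/rowP => a; rewrite /B !mxE; ring.
      exact: LD.
    - by rewrite ler_piMr// ltW.
    - by lra.
  apply: le_trans (norm3_geB _ _); rewrite norm3Z ger0_norm//.
  have H1 := LD i j (s0 + y) s' ij.
  have H2 : psi n (s0 + y) <= D / (n%:R + 1).
    apply: le_trans (psiS n _) _; apply: le_trans (Dn n).
    have Y1 : s0 + y - (s0 - h) <= ell i - h by lra.
    have Y2 : h <= s0 + y - (s0 + h) by move: ybig; lra.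
    by apply: lerB; exact: st.
  have H3 : t * psi n (s0 + y) * norm3 w <= t * (D / (n%:R + 1)) * 2.
    by apply: ler_pM => //; [exact: norm3_ge0|rewrite ler_pM2l].
  have H4 : 0 <= t * (2 * u / tau) by apply: mulr_ge0 => //; exact: ltW.
  rewrite /kap; lra.
have lim1 : - (\sum_k w 0 k * dirichlet (ell i) (f i k) (psi n)) @[n --> \oo] -->
    - (\sum_k w 0 k * (slope (f i k) (s0 - h) s0 - slope (f i k) s0 (s0 + h))).
  have C k := cvgM (cvg_cst (w 0 k))
    (@dirichlet_tent_cvg R (ell i) (ell0 i) (f i k) (s0 - h) s0 s0 (s0 + h) (fL i k) (fp i k)).
  apply: cvgN.
  under eq_fun do rewrite !big_ord_recl big_ord0.
  rewrite !big_ord_recl big_ord0.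
  by do ! [apply: cvgD; first exact: C]; exact: cvg_cst.
have lim2 : kap n / eps @[n --> \oo] --> (2 * u / tau) / eps.
  apply: cvgM; last exact: cvg_cst.
  rewrite -[X in _ --> X]addr0 -(mulr0 2).
  apply: cvgD; first exact: cvg_cst.
  by apply: cvgM; [exact: cvg_cst|exact: cvg_div_succ].
have H2 : - (\sum_k w 0 k * (slope (f i k) (s0 - h) s0 - slope (f i k) s0 (s0 + h)))
    <= 2 * u / tau / eps.
  by apply: (ler_cvg_to lim1 lim2); exact: nearW.
suff : \sum_k (slope (f i k) s0 (s0 + u) - slope (f i k) (s0 - u) s0) ^+ 2 - 12 * eta <=
  - (\sum_k w 0 k * (slope (f i k) (s0 - h) s0 - slope (f i k) s0 (s0 + h))).
  by move=> /le_trans/(_ H2); rewrite lerBlDr [leRHS]addrC.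
have -> : 12 * eta = \sum_(k < 3) 4 * eta.
  by rewrite sumr_const card_ord; ring.
rewrite -!sumrN -big_split /=; apply: ler_sum => k _.
rewrite -wE.
have wk : `|w 0 k| <= 2 by apply: le_trans (coord_le_norm3 w k) nw.
have su : s0 < s0 + u by rewrite ltrDl.
have us : s0 - u < s0 by rewrite gtrBl.
have hu1 : s0 + h <= s0 + u by rewrite lerD2l ltW.
have hu2 : s0 - u <= s0 - h by rewrite lerD2l lerN2 ltW.
have rside : closed_side s0 del s0 (s0 + u) by left; rewrite ltrD2l.
have lside : closed_side s0 del (s0 - u) s0 by right; rewrite ltrD2l ltrN2.
have R1 : slope (f i k) s0 (s0 + h) - slope (f i k) s0 (s0 + u) <= eta.
  exact: (osc k _ _ _ _ _ _ rside).
have R2 : slope (f i k) s0 (s0 + u) - slope (f i k) s0 (s0 + h) <= eta.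
  exact: (osc k _ _ _ _ _ _ rside).
have M1 : slope (f i k) (s0 - h) s0 - slope (f i k) (s0 - u) s0 <= eta.
  exact: (osc k _ _ _ _ _ _ lside).
have M2 : slope (f i k) (s0 - u) s0 - slope (f i k) (s0 - h) s0 <= eta.
  exact: (osc k _ _ _ _ _ _ lside).
move: (wE k) => wEk.
set p := slope _ s0 (s0 + h) in R1 R2 *; set q := slope _ (s0 - h) s0 in M1 M2 *.
have d1 : w 0 k - 2 * eta <= p - q by lra.
have d2 : p - q <= w 0 k + 2 * eta by lra.
have -> : - (w 0 k * (q - p)) = w 0 k * (p - q) by ring.
clear R1 R2 M1 M2 wEk.
move: wk => /ler_normlP[wk1 wk2].
move: (w 0 k) (p - q) wk1 wk2 d1 d2 => a b *; nra.
Qed.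

Lemma critical_strict i k s0 eta : 0 < eta -> exists2 del, 0 < del & forall a b c d,
  s0 - del < a -> a < b -> b < s0 + del ->
  s0 - del < c -> c < d -> d < s0 + del ->
  `|slope (f i k) a b - slope (f i k) c d| <= eta.
Proof.
move=> eta0.
(* 117 = 9 * 13: corner_estimate bounds the squared jump by 13 * eta1, which
   must not exceed (eta / 3) ^ 2. *)
pose eta1 := Num.min (eta / 3) (eta ^+ 2 / 117).
have eta10 : 0 < eta1 by rewrite lt_min !divr_gt0// exprn_gt0.
have : eta1 <= eta1 by [].
rewrite {2}/eta1 le_min => /andP[eta13 eta117].
have [del del0 osc] := closed_oscillation i s0 eta10.
pose u0 := if LThi L == 0 then del else Num.min del (eta1 * (LThi L * eps) / 2).
have [u [u_gt0 udel ub]] : exists u, [/\ 0 < u, u < del & 2 * u / LThi L / eps <= eta1].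
  have [->|tau0] := eqVneq (LThi L) 0.
    exists (del / 2); rewrite invr0 mulr0 mul0r; split; [lra|lra|exact: ltW].
  have taup : 0 < LThi L by rewrite lt_neqAle eq_sym tau0 LThi_ge0.
  have p0 : 0 < eta1 * (LThi L * eps) / 2 by rewrite divr_gt0// !mulr_gt0.
  exists (Num.min (del / 2) (eta1 * (LThi L * eps) / 2)); split.
  - by rewrite lt_min p0 andbT; lra.
  - by rewrite gt_min; apply/orP; left; lra.
  - rewrite -mulrA -invfM ler_pdivrMr ?mulr_gt0// mulrC -ler_pdivlMr//.
    by rewrite ge_min lexx orbT.
have cor := corner_estimate eta10 osc u_gt0 udel.
set P := slope (f i k) s0 (s0 + u); set M := slope (f i k) (s0 - u) s0.
have PM : `|P - M| <= eta / 3.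
  have sqle : (P - M) ^+ 2 <= (eta / 3) ^+ 2.
    apply: (@le_trans _ _ (13 * eta1)); last by rewrite expr_div_n; lra.
    apply: (@le_trans _ _ (12 * eta1 + 2 * u / LThi L / eps)); last lra.
    apply: le_trans cor; rewrite (bigD1 k)//= lerDl.
    by apply: sumr_ge0 => j _; exact: sqr_ge0.
  have e3 : 0 <= eta / 3 by lra.
  by rewrite -ler_sqr ?nnegrE// real_normK ?num_real.
exists (Num.min u (del / 2)); first by rewrite lt_min u_gt0 divr_gt0.
pose lo := Num.min P M - eta1; pose hi := Num.max P M + eta1.
have width : hi - lo <= eta.
  move: PM => /ler_normlP[? ?]; rewrite /hi /lo.
  by case: (leP P M) => ?; lra.
have [loP loM] : lo <= P - eta1 /\ lo <= M - eta1.
  by rewrite /lo; case: (leP P M) => ?; split; lra.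
have [hiP hiM] : P + eta1 <= hi /\ M + eta1 <= hi.
  by rewrite /hi; case: (leP P M) => ?; split; lra.
have right a b : s0 <= a -> a < b -> b < s0 + del -> lo <= slope (f i k) a b <= hi.
  move=> sa ab bd.
  have H1 := osc k s0 (Num.max b (s0 + u)) a b s0 (s0 + u).
  have H2 := osc k s0 (Num.max b (s0 + u)) s0 (s0 + u) a b.
  have bm : b <= Num.max b (s0 + u) by rewrite le_max lexx.
  have um : s0 + u <= Num.max b (s0 + u) by rewrite le_max lexx orbT.
  have md : Num.max b (s0 + u) < s0 + del by rewrite gt_max bd; lra.
  have su : s0 < s0 + u by lra.
  have {}H1 : slope (f i k) a b - P <= eta1 by apply: H1 => //; left.
  have {}H2 : P - slope (f i k) a b <= eta1 by apply: H2 => //; left.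
  by apply/andP; split; lra.
have left a b : s0 - del < a -> a < b -> b <= s0 -> lo <= slope (f i k) a b <= hi.
  move=> sa ab bd.
  have H1 := osc k (Num.min a (s0 - u)) s0 a b (s0 - u) s0.
  have H2 := osc k (Num.min a (s0 - u)) s0 (s0 - u) s0 a b.
  have bm : Num.min a (s0 - u) <= a by rewrite ge_min lexx.
  have um : Num.min a (s0 - u) <= s0 - u by rewrite ge_min lexx orbT.
  have md : s0 - del < Num.min a (s0 - u) by rewrite lt_min sa; lra.
  have su : s0 - u < s0 by lra.
  have {}H1 : slope (f i k) a b - M <= eta1 by apply: H1 => //; right.
  have {}H2 : M - slope (f i k) a b <= eta1 by apply: H2 => //; right.
  by apply/andP; split; lra.
have all a b : s0 - Num.min u (del / 2) < a -> a < b -> b < s0 + Num.min u (del / 2) ->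
    lo <= slope (f i k) a b <= hi.
  have ld : Num.min u (del / 2) < del by rewrite gt_min udel.
  move=> sa ab bd; have [sa0|as0] := leP s0 a; first by apply: right => //; lra.
  have [bs0|sb0] := leP b s0; first by apply: left => //; lra.
  apply: (slope_across as0 sb0); first by apply: left => //; lra.
  by apply: right => //; lra.
move=> a b c d a1 ab b1 c1 cd d1.
have /andP[? ?] := all _ _ a1 ab b1; have /andP[? ?] := all _ _ c1 cd d1.
by rewrite ler_norml; lra.
Qed.

Lemma critical_C1 : C1_link L.
Proof.
move=> i; have C k := strict_C1 (critical_strict i k).
have dL (s : R) : derivable (L i) s 1.
  by apply/derivable_mxP => a k; rewrite (ord1 a); have [] := C k.
split; first exact: dL.
move=> s.
apply/cvgrPdist_le => e e0.
have : \forall t \near s, forall k, `|derive1 (f i k) s - derive1 (f i k) t| <= e.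
  apply: (@filter_forall _ 'I_3 _ _ (nbhs_filter s)) => k; have [_ /(_ s)] := C k.
  by move=> /cvgrPdist_le/(_ _ e0).
apply: filterS => t H.
rewrite /Num.Def.normr/= mx_normrE (bigmax_le _ (ltW e0))//= => -[a k] _ /=.
rewrite (ord1 a) !derive1E !derive_mx// !mxE -!derive1E; exact: H.
Qed.

End CriticalRegularity.

Theorem proposition6p5 (R : realType) (m : nat) (ell : 'I_m -> R)
    (L : 'I_m -> R -> 'rV[R]_3) :
  rectifiable_link ell L ->
  strongly_critical_link_ropelength ell L ->
  C1_link L.
Proof. by move=> Lrect [eps eps0 Lcrit]; exact: (critical_C1 Lrect eps0 Lcrit). Qed.
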